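(* Any $5$-dimensional Sasakian Lie algebra $\mathfrak{g}$ with non-trivial center is isomorphic to one of the following Lie algebras: $$\begin{aligned} &\mathfrak{g}_1=\left(0,0,0,0,e^{12}+e^{34}\right)\simeq\mathfrak{h}_5;\\ &\mathfrak{g}_2=\left(0,-e^{12},0,0,e^{12}+e^{34}\right)\simeq\mathfrak{aff}(\mathbb{R})\times\mathfrak{h}_3;\\ &\mathfrak{g}_3=\left(0,-e^{13},e^{12},0,e^{14}+e^{23}\right)\simeq\mathbb{R}\ltimes(\mathfrak{h}_3\times\mathbb{R});\\ &\mathfrak{g}_4=\left(0,-e^{12},0,-e^{34},e^{12}+e^{34}\right)\simeq\mathfrak{aff}(\mathbb{R})\times\mathfrak{aff}(\mathbb{R})\times\mathbb{R};\\ &\mathfrak{g}_5=\left(\tfrac12 e^{14},\tfrac12 e^{24},-e^{12}+e^{34},0,e^{12}-e^{34}\right)\simeq\mathbb{R}\times(\mathbb{R}\ltimes\mathfrak{h}_3);\\ &\mathfrak{g}_6=\left(2e^{14},-e^{24},-e^{12}+e^{34},0,e^{23}\right)\simeq\mathbb{R}\ltimes\mathfrak{n}_4;\\ &\mathfrak{g}_7^{\delta}=\left(\tfrac{\delta}{2}e^{14}+e^{24},-e^{14}+\tfrac{\delta}{2}e^{24},-e^{12}+\delta e^{34},0,e^{12}-\delta e^{34}\right)\simeq\mathbb{R}\times(\mathbb{R}\ltimes\mathfrak{h}_3),\quad\delta>0;\\ &\mathfrak{g}_8^{\delta}=\left(e^{14},\delta e^{34},-\delta e^{24},0,e^{14}+e^{23}\right)\simeq\mathbb{R}\ltimes_\delta(\mathfrak{h}_3\times\mathbb{R}),\quad\delta>0.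 \end{aligned}$$
   Context: All Lie algebras are real. For a $1$-form $\alpha\in\mathfrak{g}^*$, $\mathrm{d}\alpha(X,Y)=-\alpha([X,Y])$. The notation $\mathfrak{g}=(\beta_1,\dots,\beta_5)$ means that $\mathfrak{g}^*$ has a basis $e^1,\dots,e^5$ (dual to a basis $e_1,\dots,e_5$ of $\mathfrak{g}$) with $\mathrm{d}e^k=\beta_k$; $e^{ij}=e^i\wedge e^j$, normalized so that $e^{ij}(e_i,e_j)=1$ for $i\ne j$. Thus, if $\mathrm{d}e^k=\sum_{i<j}c^k_{ij}e^{ij}$, then $[e_i,e_j]=-\sum_k c_{ij}^k e_k$ for $i<j$. A Sasakian structure on a $(2n+1)$-dimensional Lie algebra $\mathfrak{g}$ is a quadruple $(\Phi,\alpha,\xi,g)$ with $\Phi\in\mathrm{End}(\mathfrak{g})$, $\alpha\in\mathfrak{g}^*$, $\xi\in\mathfrak{g}$ and $g$ an inner product on $\mathfrak{g}$ such that for all $X,Y\in\mathfrak{g}$: $\alpha(\xi)=1$; $\Phi^2=-\mathrm{I}+\xi\otimes\alpha$; $g(\Phi X,\Phi Y)=g(X,Y)-\alpha(X)\alpha(Y)$; $2g(X,\Phi Y)=\mathrm{d}\alpha(X,Y)$; and $N_\Phi=-\mathrm{d}\alpha\otimes\xi$, where $N_\Phi(X,Y)=\Phi^2[X,Y]+[\Phi X,\Phi Y]-\Phi[\Phi X,Y]-\Phi[X,\Phi Y]$. A Sasakian Lie algebra is a Lie algebra equipped with a Sasakian structure. $\mathfrak{aff}(\mathbb{R})$ is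 the non-abelian $2$-dimensional Lie algebra; $\mathfrak{h}_{2n+1}$ is the real Heisenberg Lie algebra with basis $X_i,Y_i,Z$ ($1\le i\le n$) and only nonzero brackets $[X_i,Y_i]=Z$; $\mathfrak{n}_4$ is the $4$-dimensional filiform nilpotent Lie algebra, with basis $f_1,\dots,f_4$ and nonzero brackets $[f_1,f_2]=f_3$, $[f_1,f_3]=f_4$. The descriptions with $\ltimes$ indicate that the algebra is a semidirect product of the indicated form (the action being determined by the structure equations; the subscript $\delta$ records its dependence on $\delta$). The Lie algebras intended are those defined by the structure equations. *)

(* Defs.v *)
From HB Require Import structures.
From mathcomp Require Import all_boot all_order all_algebra.
From mathcomp Require Import ring.
From mathcomp Require Import reals.

Set Implicit Arguments.
Unset Strict Implicit.
Unset Printing Implicit Defensive.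

Import Order.TTheory GRing.Theory Num.Theory.
Local Open Scope ring_scope.

HB.mixin Record Lmodule_isLie (R : fieldType) L of GRing.Lmodule R L := {
  lie : L -> L -> L;
  lie_linearl : forall y, linear (lie^~ y);
  lie_linearr : forall x, linear (lie x);
  liexx : forall x, lie x x = 0;
  lie_jacobi : forall x y z,
    lie x (lie y z) + lie y (lie z x) + lie z (lie x y) = 0
}.

#[short(type="lieAlgType")]
HB.structure Definition LieAlg (R : fieldType) :=
  {L of Vector R L & Lmodule_isLie R L}.

Notation "[[ x , y ]]" := (lie x y) (at level 0, x, y at level 99,
  format "[[ x ,  y ]]") : ring_scope.

Section LieTheory.
Variables (R : fieldType) (g : lieAlgType R).
Implicit Types x y z : g.

HB.instance Definition _ x :=
  GRing.isLinear.Build R g g *:%R (lie x) (lie_linearr x).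

Lemma lieDl x y z : [[x + y, z]] = [[x, z]] + [[y, z]].
Proof. by have := lie_linearl z 1 x y; rewrite !scale1r. Qed.

Lemma lieDr x y z : [[x, y + z]] = [[x, y]] + [[x, z]].
Proof. by rewrite linearD. Qed.

Lemma lieZr a x y : [[x, a *: y]] = a *: [[x, y]].
Proof. by rewrite linearZ. Qed.

Lemma lie0r x : [[x, 0]] = 0. Proof. by rewrite linear0. Qed.

Lemma lieC x y : [[x, y]] = - [[y, x]].
Proof.
apply/eqP; rewrite -subr_eq0 opprK.
by have := liexx (x + y); rewrite lieDl !lieDr !liexx add0r addr0 => ->.
Qed.

Lemma lieNr x y : [[x, - y]] = - [[x, y]].
Proof. by rewrite linearN. Qed.

End LieTheory.

Definition lie_isog (R : fieldType) (g h : lieAlgType R) : Prop :=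
  exists f : {linear g -> h}, bijective f /\ forall x y, f [[x, y]] = [[f x, f y]].

Notation "g ~= h" := (lie_isog g h) (at level 70) : type_scope.

Definition in_center (R : fieldType) (g : lieAlgType R) (z : g) : Prop :=
  forall x, [[z, x]] = 0.

Definition nontrivial_center (R : fieldType) (g : lieAlgType R) : Prop :=
  exists2 z : g, in_center z & z != 0.

Definition dform (R : fieldType) (g : lieAlgType R) (alpha : {scalar g})
    (x y : g) : R :=
  - alpha [[x, y]].

Definition nijenhuis (R : fieldType) (g : lieAlgType R) (Phi : 'End(g))
    (x y : g) : g :=
  Phi (Phi [[x, y]]) + [[Phi x, Phi y]] - Phi [[Phi x, y]] - Phi [[x, Phi y]].

(* {dot g for idfun}: symmetric positive definite bilinear forms. *)
Record sasakian (R : realType) (g : lieAlgType R) := Sasakian {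
  sas_Phi : 'End(g);
  sas_alpha : {scalar g};
  sas_xi : g;
  sas_metric : {dot g for (@idfun R)};
  sas_alpha_xi : sas_alpha sas_xi = 1;
  sas_PhiK : forall X, sas_Phi (sas_Phi X) = - X + sas_alpha X *: sas_xi;
  sas_metric_Phi : forall X Y,
    sas_metric (sas_Phi X) (sas_Phi Y) =
      sas_metric X Y - sas_alpha X * sas_alpha Y;
  sas_metric_dalpha : forall X Y,
    2 * sas_metric X (sas_Phi Y) = dform sas_alpha X Y;
  sas_nijenhuis : forall X Y,
    nijenhuis sas_Phi X Y = - (dform sas_alpha X Y *: sas_xi)
}.

Section Abelian.
Variables (R : fieldType) (V : vectType R).

Definition abelian : Type := V.

HB.instance Definition _ := Vector.on abelian.

Definition abelian_bracket (x y : V) : V := 0.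

Fact abelian_linearl y : linear (abelian_bracket^~ y).
Proof. by move=> a u v; rewrite /abelian_bracket scaler0 addr0. Qed.

Fact abelian_linearr x : linear (abelian_bracket x).
Proof. by move=> a u v; rewrite /abelian_bracket scaler0 addr0. Qed.

Fact abelian_alt x : abelian_bracket x x = 0. Proof. by []. Qed.

Fact abelian_jacobi x y z :
  abelian_bracket x (abelian_bracket y z)
    + abelian_bracket y (abelian_bracket z x)
    + abelian_bracket z (abelian_bracket x y) = 0.
Proof. by rewrite /abelian_bracket !addr0. Qed.

HB.instance Definition _ := Lmodule_isLie.Build R abelian
  abelian_linearl abelian_linearr abelian_alt abelian_jacobi.

End Abelian.

Section Product.
Variables (R : fieldType) (g h : lieAlgType R).

Definition prod_bracket (x y : g * h) : g * h := ([[x.1, y.1]], [[x.2, y.2]]).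

Fact prod_linearl y : linear (prod_bracket^~ y).
Proof. by move=> a u v; rewrite /prod_bracket !lie_linearl. Qed.

Fact prod_linearr x : linear (prod_bracket x).
Proof. by move=> a u v; rewrite /prod_bracket !lie_linearr. Qed.

Fact prod_alt x : prod_bracket x x = 0.
Proof. by rewrite /prod_bracket !liexx. Qed.

Fact prod_jacobi x y z :
  prod_bracket x (prod_bracket y z) + prod_bracket y (prod_bracket z x)
    + prod_bracket z (prod_bracket x y) = 0.
Proof. by congr pair; rewrite /= lie_jacobi. Qed.

HB.instance Definition _ := Lmodule_isLie.Build R (g * h)%type
  prod_linearl prod_linearr prod_alt prod_jacobi.

End Product.

(* act_der and act_lie say that act is a Lie algebra morphism h -> Der(n). *)
Record lie_action (R : fieldType) (h n : lieAlgType R) := LieAction {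
  act :> {linear h -> 'End(n)};
  act_der : forall x u v, act x [[u, v]] = [[act x u, v]] + [[u, act x v]];
  act_lie : forall x y u, act [[x, y]] u = act x (act y u) - act y (act x u)
}.

Section Semidirect.
Import VectorInternalTheory.
Variables (R : fieldType) (h n : lieAlgType R).

Definition semidirect (rho : lie_action h n) : Type := (h * n)%type.

Variable rho : lie_action h n.

HB.instance Definition _ := Vector.on (semidirect rho).

Definition semidirect_bracket (x y : h * n) : h * n :=
  ([[x.1, y.1]], [[x.2, y.2]] + rho x.1 y.2 - rho y.1 x.2).

Fact semidirect_linearl y : linear (semidirect_bracket^~ y).
Proof.
move=> a u v; rewrite /semidirect_bracket /=; congr pair.
  exact: lie_linearl.
rewrite /= lie_linearl [rho (_ + _)]linearP [rho y.1 _]linearP.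
rewrite add_lfunE scale_lfunE /= scalerBr scalerDr opprD.
by rewrite (addrACA (a *: _)) [LHS]addrACA.
Qed.

Fact semidirect_linearr x : linear (semidirect_bracket x).
Proof.
move=> a u v; rewrite /semidirect_bracket /=; congr pair.
  exact: lie_linearr.
rewrite /= lie_linearr [rho (_ + _)]linearP [rho x.1 _]linearP add_lfunE scale_lfunE.
rewrite /= scalerBr scalerDr opprD.
by rewrite (addrACA (a *: _)) [LHS]addrACA.
Qed.

Fact semidirect_alt x : semidirect_bracket x x = 0.
Proof. by rewrite /semidirect_bracket !liexx add0r subrr. Qed.

Fact semidirect_jacobi x y z :
  semidirect_bracket x (semidirect_bracket y z)
    + semidirect_bracket y (semidirect_bracket z x)
    + semidirect_bracket z (semidirect_bracket x y) = 0.
Proof.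
case: x y z => [x u] [y v] [z w]; congr pair; rewrite /= ?lie_jacobi //.
rewrite !lieDr !lieNr !(linearD (rho _)) !(linearN (rho _)) /= !act_der !act_lie.
rewrite (lieC (rho x v)) (lieC (rho y w)) (lieC (rho z u)).
have J : [[u, [[v, w]]]] = - [[v, [[w, u]]]] - [[w, [[u, v]]]].
  by apply/eqP; rewrite -opprD -addr_eq0 addrA lie_jacobi.
rewrite J; apply: (can_inj v2rK).
set f := v2r.
have fD s t : f (s + t) = f s + f t by rewrite /f linearD.
have fN t : f (- t) = - f t by rewrite /f linearN.
have f0 : f 0 = 0 by rewrite /f linear0.
by apply/rowP => i; rewrite !(fD, fN, f0) !mxE; ring.
Qed.

HB.instance Definition _ := Lmodule_isLie.Build R (semidirect rho)
  semidirect_linearl semidirect_linearr semidirect_alt semidirect_jacobi.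

End Semidirect.

Section Heisenberg.
Variables (R : fieldType) (n : nat).

(* ((x, y), z) stands for sum_i x_i X_i + sum_i y_i Y_i + z Z. *)
Definition heis : Type := ('rV[R]_n * 'rV[R]_n * R^o)%type.

HB.instance Definition _ := Vector.on heis.

Definition heis_bracket (u v : 'rV[R]_n * 'rV[R]_n * R^o) :
    'rV[R]_n * 'rV[R]_n * R^o :=
  (0, \sum_i (u.1.1 0 i * v.1.2 0 i - v.1.1 0 i * u.1.2 0 i)).

Fact heis_linearl v : linear (heis_bracket^~ v).
Proof.
move=> a u w; congr pair; rewrite /= ?scaler0 ?addr0 //.
rewrite scaler_sumr -big_split; apply: eq_bigr => i _ /=.
by rewrite !mxE /GRing.scale /=; ring.
Qed.

Fact heis_linearr u : linear (heis_bracket u).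
Proof.
move=> a v w; congr pair; rewrite /= ?scaler0 ?addr0 //.
rewrite scaler_sumr -big_split; apply: eq_bigr => i _ /=.
by rewrite !mxE /GRing.scale /=; ring.
Qed.

Fact heis_alt u : heis_bracket u u = 0.
Proof. by congr pair; apply: big1 => i _; rewrite subrr. Qed.

Fact heis_jacobi u v w :
  heis_bracket u (heis_bracket v w) + heis_bracket v (heis_bracket w u)
    + heis_bracket w (heis_bracket u v) = 0.
Proof.
have h0 p q r : heis_bracket p (heis_bracket q r) = 0.
  by congr pair; apply: big1 => i _; rewrite /= !mxE mulr0 mul0r subrr.
by rewrite !h0 !addr0.
Qed.

HB.instance Definition _ := Lmodule_isLie.Build R heis
  heis_linearl heis_linearr heis_alt heis_jacobi.

End Heisenberg.

(* A 2-form on R^n is encoded by its (alternating) Gram matrix. *)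
Definition ev2 (R : fieldType) n (b : 'M[R]_n) (x y : 'rV[R]_n) : R :=
  (x *m b *m y^T) 0 0.

(* e^{ij} = e^i /\ e^j, with indices starting from 1. *)
Definition e_ (R : fieldType) n (i j : nat) : 'M[R]_n :=
  \matrix_(a, b) (((a.+1 == i) && (b.+1 == j))%:R -
                  ((a.+1 == j) && (b.+1 == i))%:R).

Arguments e_ {R n} i j.

(* The bracket on R^n for which the canonical coframe satisfies d e^k = b_k. *)
Definition coframe_bracket (R : fieldType) n (b : n.-tuple 'M[R]_n)
    (x y : 'rV[R]_n) : 'rV[R]_n :=
  - \row_k ev2 (tnth b k) x y.

Record coframe (R : fieldType) n := Coframe {
  coframe_val :> n.-tuple 'M[R]_n;
  coframe_alt : forall x, coframe_bracket coframe_val x x = 0;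
  coframe_jacobi : forall x y z, let br := coframe_bracket coframe_val in
    br x (br y z) + br y (br z x) + br z (br x y) = 0
}.

Section CoframeAlgebra.
Variables (R : fieldType) (n : nat).

Definition coframe_alg (b : coframe R n) := 'rV[R]_n.

Variable b : coframe R n.

HB.instance Definition _ := Vector.on (coframe_alg b).

Fact coframe_linearl y : linear ((coframe_bracket b)^~ y).
Proof.
move=> a u v; apply/rowP => k; rewrite !mxE /ev2 !mulmxDl -!scalemxAl !mxE.
by rewrite opprD mulrN.
Qed.

Fact coframe_linearr x : linear (coframe_bracket b x).
Proof.
move=> a u v; apply/rowP => k.
by rewrite !mxE /ev2 linearP mulmxDr -scalemxAr !mxE opprD mulrN.
Qed.

HB.instance Definition _ := Lmodule_isLie.Build R (coframe_alg b)
  coframe_linearl coframe_linearr (@coframe_alt _ _ b) (@coframe_jacobi _ _ b).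

End CoframeAlgebra.

Section CoframeTheory.
Variables (R : fieldType) (n : nat).
Implicit Types (b : coframe R n) (x y : 'rV[R]_n).

Definition coframe_form b (k : 'I_n) (x : coframe_alg b) : R := (x : 'rV[R]_n) 0 k.

Fact coframe_form_linear b k : linear_for *%R (@coframe_form b k).
Proof. by move=> a u v; rewrite /coframe_form !mxE. Qed.

HB.instance Definition _ b k :=
  GRing.isLinear.Build R (coframe_alg b) R *%R (@coframe_form b k) (@coframe_form_linear b k).

Lemma dcoframe_form b k (x y : coframe_alg b) :
  dform (@coframe_form b k) x y = ev2 (tnth b k) x y.
Proof.
suff -> : dform (@coframe_form b k) x y = - (coframe_bracket b x y 0 k).
  by rewrite !mxE opprK.
by [].
Qed.

End CoframeTheory.

(* Coordinates indexed from 1 by natural numbers, used only to check by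
   computation the axioms of the algebras below. *)
Section CoframeCompute.
Variables (R : fieldType) (n : nat).
Implicit Types (b : n.-tuple 'M[R]_n) (x y z : 'rV[R]_n).

Definition co x (i : nat) : R := if insub i.-1 is Some k then x 0 k else 0.

Lemma ev2D p q x y : ev2 (p + q) x y = ev2 p x y + ev2 q x y.
Proof. by rewrite /ev2 mulmxDr mulmxDl mxE. Qed.

Lemma ev2N p x y : ev2 (- p) x y = - ev2 p x y.
Proof. by rewrite /ev2 mulmxN mulNmx mxE. Qed.

Lemma ev2Z a p x y : ev2 (a *: p) x y = a * ev2 p x y.
Proof. by rewrite /ev2 -scalemxAr -scalemxAl mxE. Qed.

Lemma ev20 x y : ev2 0 x y = 0.
Proof. by rewrite /ev2 mulmx0 mul0mx mxE. Qed.

Lemma ev2_e i j x y : (0 < i <= n)%N -> (0 < j <= n)%N ->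
  ev2 (e_ i j) x y = co x i * co y j - co x j * co y i.
Proof.
case: i j => [//|i] [//|j] /= hi hj; rewrite /co /= !insubT.
set i' := Sub i hi; set j' := Sub j hj.
have -> : e_ i.+1 j.+1 = delta_mx i' j' - delta_mx j' i' :> 'M[R]_n.
  by apply/matrixP => a c; rewrite !mxE !eqSS.
rewrite ev2D ev2N; have E a c : ev2 (delta_mx a c) x y = x 0 a * y 0 c.
  rewrite /ev2 mxE (bigD1 c) //= big1 => [|k kc].
    rewrite addr0 !mxE (bigD1 a) //= big1 => [|l la]; last first.
      by rewrite !mxE (negPf la) mulr0.
    by rewrite !mxE !eqxx mulr1 addr0.
  by rewrite mxE big1 ?mul0r // => l _; rewrite !mxE (negPf kc) andbF mulr0.
by rewrite !E.
Qed.

Lemma co_bracket b x y i : (0 < i <= n)%N ->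
  co (coframe_bracket b x y) i = - ev2 (nth 0 b i.-1) x y.
Proof.
by case: i => // i /= hi; rewrite /co /= insubT !mxE (tnth_nth 0).
Qed.

Lemma coP x y : (forall i, i \in iota 1 n -> co x i = co y i) -> x = y.
Proof.
move=> h; apply/rowP => k; have := h k.+1; rewrite mem_iota /co /= valK.
by apply; rewrite add1n ltnS ltn_ord.
Qed.

Lemma coD x y i : co (x + y) i = co x i + co y i.
Proof. by rewrite /co; case: insub => [k|]; rewrite ?addr0 ?mxE. Qed.

Lemma co0 i : co 0 i = 0.
Proof. by rewrite /co; case: insub => [k|]; rewrite ?mxE. Qed.

End CoframeCompute.

Ltac coframe_tac :=
  move=> * /=; apply: coP => i; rewrite !inE /=;
  do ?[case/orP]; move=> /eqP ->;
  rewrite ?coD ?co0 ?co_bracket //=;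
  do 2! [rewrite ?(ev2D, ev2N, ev2Z, ev20) ?ev2_e // ?co_bracket //=];
  try by []; field; by rewrite ?pnatr_eq0.

(* As [e_i, e_j] = - sum_k b_k(e_i, e_j) e_k, the only bracket is [e_1, e_2] = e_2. *)
Definition aff_eq (R : fieldType) : 2.-tuple 'M[R]_2 :=
  [tuple 0; - e_ 1 2].

Fact aff_alt (R : fieldType) x : coframe_bracket (aff_eq R) x x = 0.
Proof. coframe_tac. Qed.

Fact aff_jacobi (R : fieldType) x y z :
  let br := coframe_bracket (aff_eq R) in
  br x (br y z) + br y (br z x) + br z (br x y) = 0.
Proof. coframe_tac. Qed.

Definition aff (R : fieldType) : lieAlgType R :=
  coframe_alg (Coframe (@aff_alt R) (@aff_jacobi R)).

(* [f_1, f_2] = f_3 and [f_1, f_3] = f_4. *)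
Definition n4_eq (R : fieldType) : 4.-tuple 'M[R]_4 :=
  [tuple 0; 0; - e_ 1 2; - e_ 1 3].

Fact n4_alt (R : fieldType) x : coframe_bracket (n4_eq R) x x = 0.
Proof. coframe_tac. Qed.

Fact n4_jacobi (R : fieldType) x y z :
  let br := coframe_bracket (n4_eq R) in
  br x (br y z) + br y (br z x) + br z (br x y) = 0.
Proof. coframe_tac. Qed.

Definition n4 (R : fieldType) : lieAlgType R :=
  coframe_alg (Coframe (@n4_alt R) (@n4_jacobi R)).

Definition g1_eq (R : realType) : 5.-tuple 'M[R]_5 :=
  [tuple 0; 0; 0; 0; e_ 1 2 + e_ 3 4].

Fact g1_alt (R : realType) x : coframe_bracket (g1_eq R) x x = 0.
Proof. coframe_tac. Qed.

Fact g1_jacobi (R : realType) x y z :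
  let br := coframe_bracket (g1_eq R) in
  br x (br y z) + br y (br z x) + br z (br x y) = 0.
Proof. coframe_tac. Qed.

Definition g1 (R : realType) : lieAlgType R :=
  coframe_alg (Coframe (@g1_alt R) (@g1_jacobi R)).

Definition g2_eq (R : realType) : 5.-tuple 'M[R]_5 :=
  [tuple 0; - e_ 1 2; 0; 0; e_ 1 2 + e_ 3 4].

Fact g2_alt (R : realType) x : coframe_bracket (g2_eq R) x x = 0.
Proof. coframe_tac. Qed.

Fact g2_jacobi (R : realType) x y z :
  let br := coframe_bracket (g2_eq R) in
  br x (br y z) + br y (br z x) + br z (br x y) = 0.
Proof. coframe_tac. Qed.

Definition g2 (R : realType) : lieAlgType R :=
  coframe_alg (Coframe (@g2_alt R) (@g2_jacobi R)).

Definition g3_eq (R : realType) : 5.-tuple 'M[R]_5 :=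
  [tuple 0; - e_ 1 3; e_ 1 2; 0; e_ 1 4 + e_ 2 3].

Fact g3_alt (R : realType) x : coframe_bracket (g3_eq R) x x = 0.
Proof. coframe_tac. Qed.

Fact g3_jacobi (R : realType) x y z :
  let br := coframe_bracket (g3_eq R) in
  br x (br y z) + br y (br z x) + br z (br x y) = 0.
Proof. coframe_tac. Qed.

Definition g3 (R : realType) : lieAlgType R :=
  coframe_alg (Coframe (@g3_alt R) (@g3_jacobi R)).

Definition g4_eq (R : realType) : 5.-tuple 'M[R]_5 :=
  [tuple 0; - e_ 1 2; 0; - e_ 3 4; e_ 1 2 + e_ 3 4].

Fact g4_alt (R : realType) x : coframe_bracket (g4_eq R) x x = 0.
Proof. coframe_tac. Qed.

Fact g4_jacobi (R : realType) x y z :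
  let br := coframe_bracket (g4_eq R) in
  br x (br y z) + br y (br z x) + br z (br x y) = 0.
Proof. coframe_tac. Qed.

Definition g4 (R : realType) : lieAlgType R :=
  coframe_alg (Coframe (@g4_alt R) (@g4_jacobi R)).

Definition g5_eq (R : realType) : 5.-tuple 'M[R]_5 :=
  [tuple 2^-1 *: e_ 1 4; 2^-1 *: e_ 2 4; - e_ 1 2 + e_ 3 4; 0;
    e_ 1 2 - e_ 3 4].

Fact g5_alt (R : realType) x : coframe_bracket (g5_eq R) x x = 0.
Proof. coframe_tac. Qed.

Fact g5_jacobi (R : realType) x y z :
  let br := coframe_bracket (g5_eq R) in
  br x (br y z) + br y (br z x) + br z (br x y) = 0.
Proof. coframe_tac. Qed.

Definition g5 (R : realType) : lieAlgType R :=
  coframe_alg (Coframe (@g5_alt R) (@g5_jacobi R)).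

Definition g6_eq (R : realType) : 5.-tuple 'M[R]_5 :=
  [tuple 2 *: e_ 1 4; - e_ 2 4; - e_ 1 2 + e_ 3 4; 0; e_ 2 3].

Fact g6_alt (R : realType) x : coframe_bracket (g6_eq R) x x = 0.
Proof. coframe_tac. Qed.

Fact g6_jacobi (R : realType) x y z :
  let br := coframe_bracket (g6_eq R) in
  br x (br y z) + br y (br z x) + br z (br x y) = 0.
Proof. coframe_tac. Qed.

Definition g6 (R : realType) : lieAlgType R :=
  coframe_alg (Coframe (@g6_alt R) (@g6_jacobi R)).

Definition g7_eq (R : realType) (delta : R) : 5.-tuple 'M[R]_5 :=
  [tuple (delta / 2) *: e_ 1 4 + e_ 2 4; - e_ 1 4 + (delta / 2) *: e_ 2 4;
    - e_ 1 2 + delta *: e_ 3 4; 0; e_ 1 2 - delta *: e_ 3 4].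

Fact g7_alt (R : realType) (delta : R) x : coframe_bracket (g7_eq delta) x x = 0.
Proof. coframe_tac. Qed.

Fact g7_jacobi (R : realType) (delta : R) x y z :
  let br := coframe_bracket (g7_eq delta) in
  br x (br y z) + br y (br z x) + br z (br x y) = 0.
Proof. coframe_tac. Qed.

Definition g7 (R : realType) (delta : R) : lieAlgType R :=
  coframe_alg (Coframe (@g7_alt R delta) (@g7_jacobi R delta)).

Definition g8_eq (R : realType) (delta : R) : 5.-tuple 'M[R]_5 :=
  [tuple e_ 1 4; delta *: e_ 3 4; - (delta *: e_ 2 4); 0;
    e_ 1 4 + e_ 2 3].

Fact g8_alt (R : realType) (delta : R) x : coframe_bracket (g8_eq delta) x x = 0.
Proof. coframe_tac. Qed.

Fact g8_jacobi (R : realType) (delta : R) x y z :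
  let br := coframe_bracket (g8_eq delta) in
  br x (br y z) + br y (br z x) + br z (br x y) = 0.
Proof. coframe_tac. Qed.

Definition g8 (R : realType) (delta : R) : lieAlgType R :=
  coframe_alg (Coframe (@g8_alt R delta) (@g8_jacobi R delta)).

(* Main.v *)
Require Import Defs.
From HB Require Import structures.
From mathcomp Require Import all_boot all_order all_algebra.
From mathcomp Require Import ring lra.
From mathcomp Require Import reals.

Set Implicit Arguments.
Unset Strict Implicit.
Unset Printing Implicit Defensive.

Import Order.TTheory GRing.Theory Num.Theory.
Local Open Scope ring_scope.

(** A central element z of a Sasakian Lie algebra satisfies d alpha (z, .) =
    0, so the centre is spanned by the Reeb vector xi ([xi_central]), and the
    algebra is the central extension, by its Kaehler form, of the
    4-dimensional Kaehler Lie algebra g / xi. The latter is described by a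
    unitary coframe e^1, ..., e^4 with J e_1 = e_2 and J e_3 = e_4; the fifth
    form is a multiple of alpha.

    The key point is that the quotient carries a nonzero closed 1-form
    ([exists_closed_form]): either the trace of ad, or, in the unimodular
    case, a form whose differential is anti-self-dual and has square zero.
    Taking the frame so that e^1 is this form, the torsion-free unitary
    connection is left with ten real coefficients ([kahler_coframing]), and
    rotations of (e^3, e^4) remove some of them.

    The Jacobi identity then becomes a system of quadratic equations. Either
    two of the forms are closed, and the structure constants are those of a
    binary cubic form whose polar matrices commute; diagonalizing it exhibits
    the quotient as a product of two algebras of dimension 2
    ([classify_two_closed]). Or the equations factor ([classify_reduced]) and
    each factor gives one of the listed algebras, by an explicit change of
    coframe. The descriptions as products and semidirect products are explicit
    isomorphisms too. *)

(** * Linear maps and coordinates *)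

Lemma inj_linear_bij (R : fieldType) (U V : vectType R) (f : {linear U -> V}) :
  injective f -> \dim {:U} = \dim {:V} -> bijective f.
Proof.
move=> injf eq_dim; pose F := linfun f.
have FE x : F x = f x by rewrite lfunE.
have kF : lker F == 0%VS by apply/lker0P => x y; rewrite !FE; apply: injf.
have imF : limg F = fullv.
  apply/eqP; rewrite eqEdim subvf /= -eq_dim.
  by rewrite -(limg_dim_eq (f := F) (U := fullv)) // (eqP kF) capv0.
exists (F^-1)%VF => x; first by rewrite -FE lker0_lfunK.
by rewrite -FE limg_lfunVK // imF memvf.
Qed.

Lemma nontrivial_kernel (R : fieldType) (V : vectType R) n (f : V -> 'rV[R]_n) :
  linear f -> (n < \dim {:V})%N -> exists2 x, x != 0 & f x = 0.
Proof.
move=> linf ltn; pose fl := HB.pack_for {linear V -> 'rV[R]_n} f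
  (GRing.isLinear.Build _ _ _ _ f linf).
exists (vpick (lker (linfun fl))); last first.
  by apply/eqP; have := memv_pick (lker (linfun fl)); rewrite memv_ker lfunE.
rewrite vpick0 -dimv_eq0 -lt0n -(ltn_add2r n) add0n.
apply: leq_trans ltn _; rewrite -(limg_ker_dim (linfun fl)) capfv leq_add2l.
by have := dimvS (subvf (limg (linfun fl))); rewrite [X in (_ <= X)%N]dimvf /dim /= mul1n.
Qed.

Section Vec.
Variables (R : fieldType) (n : nat).
Implicit Types x : 'rV[R]_n.

(** The row vector whose coordinates, in the numbering from 1 of [co], are
    listed by [s]. *)
Definition vec (s : seq R) : 'rV[R]_n := \row_k s`_k.

Lemma co_vec s i : (0 < i <= n)%N -> co (vec s) i = s`_i.-1.
Proof. by case: i => // i hi; rewrite /co /= insubT !mxE. Qed.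

Lemma coZ a x i : co (a *: x) i = a * co x i.
Proof. by rewrite /co; case: insub => [k|]; rewrite ?mulr0 ?mxE. Qed.

Lemma coN x i : co (- x) i = - co x i.
Proof. by rewrite -scaleN1r coZ mulN1r. Qed.

Lemma co_ord x (i : 'I_n) : co x i.+1 = x 0 i.
Proof. by rewrite /co /= valK. Qed.

End Vec.

(** * Coframings *)

Section Coframings.
Variables (R : fieldType) (n : nat).
Implicit Types (g : lieAlgType R) (b : n.-tuple 'M[R]_n).

(** The forms e^1, ..., e^n are the coordinates of [t], and the equation is
    d e^k = b_k. As b is a bare tuple of 2-forms, no Jacobi identity has to be
    checked for an intermediate coframing. *)
Definition has_coframing g b : Prop :=
  exists t : {linear g -> 'rV[R]_n},
    injective t /\ forall x y, t [[x, y]] = coframe_bracket b (t x) (t y).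

Lemma coframing_isog g (b : coframe R n) :
  \dim {:g} = n -> has_coframing g b -> g ~= coframe_alg b.
Proof.
move=> dimg [t [injt tlie] ]; exists t; split=> //.
by apply: inj_linear_bij injt _; rewrite dimg dimvf /= /dim /= mul1n.
Qed.

Lemma change_coframing g b b' (F G : 'rV[R]_n -> 'rV[R]_n) :
    linear F -> cancel F G ->
    (forall x y, F (coframe_bracket b x y) = coframe_bracket b' (F x) (F y)) ->
  has_coframing g b -> has_coframing g b'.
Proof.
move=> linF FK Flie [t [injt tlie] ].
pose Fl := HB.pack_for {linear 'rV[R]_n -> 'rV[R]_n} F
  (GRing.isLinear.Build _ _ _ _ F linF).
exists (Fl \o t : {linear g -> 'rV[R]_n}); split=> [|x y /=]; last by rewrite tlie Flie.
exact: (inj_comp (f := Fl)) (can_inj FK) injt.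
Qed.

Lemma coframing_jacobi g b : \dim {:g} = n -> has_coframing g b ->
  forall x y z, let br := coframe_bracket b in
    br x (br y z) + br y (br z x) + br z (br x y) = 0.
Proof.
move=> dimg [t [injt tlie] ] x y z /=.
have [|s _ sK] := inj_linear_bij injt.
  by rewrite dimg dimvf /= /dim /= mul1n.
by rewrite -(sK x) -(sK y) -(sK z) -!tlie -!linearD lie_jacobi linear0.
Qed.

End Coframings.

Lemma coframing_of_function (R : fieldType) n (g : lieAlgType R)
    (b : n.-tuple 'M[R]_n) (t : g -> 'rV[R]_n) :
    linear t -> injective t ->
    (forall x y, t [[x, y]] = coframe_bracket b (t x) (t y)) ->
  has_coframing g b.
Proof.
move=> lint injt tlie; pose tl := HB.pack_for {linear g -> 'rV[R]_n} t
  (GRing.isLinear.Build _ _ _ _ t lint).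
by exists tl.
Qed.

Lemma co_lie (R : fieldType) n (b : coframe R n) (x y : coframe_alg b) i :
  (0 < i <= n)%N -> co [[x, y]] i = - ev2 (nth 0 b i.-1) x y.
Proof. exact: co_bracket. Qed.

Ltac each_coordinate :=
  apply: coP => i; rewrite !inE; do ?[case/orP]; move=> /eqP ->.

Ltac expand_coordinates :=
  rewrite ?(coD, coZ, co0) ?co_vec ?co_bracket //=;
  rewrite ?(ev2D, ev2N, ev2Z, ev20) ?ev2_e // ?co_vec ?(coD, coZ, co0) ?co_bracket //=;
  rewrite ?(ev2D, ev2N, ev2Z, ev20) ?ev2_e //.

Ltac nonzero :=
  do ?[apply/andP; split]; rewrite ?(oppr_eq0, mulf_neq0, invr_eq0, pnatr_eq0) //.
Ltac linear_tac := by move=> ? ? ?; each_coordinate; expand_coordinates; ring.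
Ltac cancel_tac :=
  by move=> ?; each_coordinate; rewrite ?co_vec //=; field; nonzero.
Ltac lie_tac :=
  by move=> ? ?; each_coordinate; expand_coordinates; field; nonzero.

Ltac cancel_tac_mod E :=
  by move=> ?; each_coordinate; rewrite ?co_vec //=; field: E; nonzero.
Ltac lie_tac_mod E :=
  by move=> ? ?; each_coordinate; expand_coordinates; field: E; nonzero.

(** * Structure equations with a closed form in a unitary coframe *)

(** The structure equations of a central extension by the Kaehler form
    e^12 + e^34 of a Kaehler Lie algebra whose unitary coframe has e^1 closed.
    With theta^1 = e^1 + i e^2 and theta^2 = e^3 + i e^4, the Levi-Civita
    connection is u(2)-valued, so that
      d theta^1 = - i A theta^1 - C theta^2 and
      d theta^2 = conj(C) theta^1 - i B theta^2
    for real 1-forms A, B and a complex one C = P + i Q. By Cartan's lemma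
    d e^1 = 0 means that (A, - P, Q) is obtained from (e^2, e^3, e^4) by a
    symmetric matrix, with rows (a, b, c), (b, d, f), (c, f, h); and
    B = p e^1 + q e^2 + r e^3 + s e^4. *)
Definition kahler_eq (R : realType) (a b c d f h p q r s : R) : 5.-tuple 'M[R]_5 :=
  [tuple 0;
    a *: e_ 1 2 + b *: e_ 1 3 + c *: e_ 1 4 - c *: e_ 2 3 + b *: e_ 2 4
      + (d + h) *: e_ 3 4;
    b *: e_ 1 2 + d *: e_ 1 3 + (f + p) *: e_ 1 4 - f *: e_ 2 3
      + (q - h) *: e_ 2 4 + r *: e_ 3 4;
    c *: e_ 1 2 + (f - p) *: e_ 1 3 + h *: e_ 1 4 + (d - q) *: e_ 2 3
      + f *: e_ 2 4 + s *: e_ 3 4;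
    e_ 1 2 + e_ 3 4].

Section Leaves.
Variables (R : realType) (g : lieAlgType R).
Hypothesis dimg : \dim {:g} = 5%N.

Lemma kahler_eq_isog_g1 :
  has_coframing g (kahler_eq 0 0 0 0 0 0 0 0 0 0) -> g ~= g1 R.
Proof.
move=> H; apply: (coframing_isog dimg).
apply: (change_coframing
  (F := fun x => vec 5 [:: co x 1; co x 2; co x 3; co x 4; co x 5])
  (G := fun y => vec 5 [:: co y 1; co y 2; co y 3; co y 4; co y 5]) _ _ _ H).
- linear_tac.
- cancel_tac.
- lie_tac.
Qed.

Lemma kahler_eq_isog_g2_flat (a : R) : a != 0 ->
  has_coframing g (kahler_eq a 0 0 0 0 0 0 0 0 0) -> g ~= g2 R.
Proof.
move=> a0 H; apply: (coframing_isog dimg).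
apply: (change_coframing
  (F := fun x => vec 5 [:: - a * co x 1; co x 2; co x 3; co x 4;
      co x 5 - co x 2 / a - co x 2])
  (G := fun y => vec 5 [:: - co y 1 / a; co y 2; co y 3; co y 4;
      co y 5 + co y 2 / a + co y 2]) _ _ _ H).
- linear_tac.
- cancel_tac.
- lie_tac.
Qed.

Lemma kahler_eq_isog_g2 (r s : R) : r ^+ 2 + s ^+ 2 != 0 ->
  has_coframing g (kahler_eq 0 0 0 0 0 0 0 0 r s) -> g ~= g2 R.
Proof.
move=> N0 H; apply: (coframing_isog dimg).
apply: (change_coframing
  (F := fun x => vec 5 [:: r * co x 4 - s * co x 3; r * co x 3 + s * co x 4;
      co x 1; co x 2;
      co x 5 - (r * co x 3 + s * co x 4) / (r ^+ 2 + s ^+ 2) - (r * co x 3 + s * co x 4)])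
  (G := fun y => vec 5 [:: co y 3; co y 4;
      (r * co y 2 - s * co y 1) / (r ^+ 2 + s ^+ 2);
      (s * co y 2 + r * co y 1) / (r ^+ 2 + s ^+ 2);
      co y 5 + co y 2 / (r ^+ 2 + s ^+ 2) + co y 2]) _ _ _ H).
- linear_tac.
- cancel_tac.
- lie_tac.
Qed.

Lemma kahler_eq_isog_g4 (a r s : R) : a != 0 -> r ^+ 2 + s ^+ 2 != 0 ->
  has_coframing g (kahler_eq a 0 0 0 0 0 0 0 r s) -> g ~= g4 R.
Proof.
move=> a0 N0 H; apply: (coframing_isog dimg).
apply: (change_coframing
  (F := fun x => vec 5 [:: r * co x 4 - s * co x 3; r * co x 3 + s * co x 4;
      - a * co x 1; co x 2;
      co x 5 - co x 2 / a - (r * co x 3 + s * co x 4) / (r ^+ 2 + s ^+ 2) - (r * co x 3 + s * co x 4) - co x 2])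
  (G := fun y => vec 5 [:: - co y 3 / a; co y 4;
      (r * co y 2 - s * co y 1) / (r ^+ 2 + s ^+ 2);
      (s * co y 2 + r * co y 1) / (r ^+ 2 + s ^+ 2);
      co y 5 + co y 4 / a + co y 2 / (r ^+ 2 + s ^+ 2) + co y 2 + co y 4]) _ _ _ H).
- linear_tac.
- cancel_tac.
- lie_tac.
Qed.

Lemma kahler_eq_isog_g3 (p q : R) : p ^+ 2 + q ^+ 2 != 0 ->
  has_coframing g (kahler_eq 0 0 0 0 0 0 p q 0 0) -> g ~= g3 R.
Proof.
move=> N0 H; apply: (coframing_isog dimg).
apply: (change_coframing
  (F := fun x => vec 5 [:: p * co x 1 + q * co x 2; co x 4; co x 3;
      (q * co x 1 - p * co x 2) / (p ^+ 2 + q ^+ 2); - co x 5])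
  (G := fun y => vec 5 [:: p * co y 1 / (p ^+ 2 + q ^+ 2) + q * co y 4;
      q * co y 1 / (p ^+ 2 + q ^+ 2) - p * co y 4; co y 3; co y 2;
      - co y 5]) _ _ _ H).
- linear_tac.
- cancel_tac.
- lie_tac.
Qed.

(** The sign t, here and for g7, serves to make the parameter positive. *)
Lemma kahler_eq_isog_g8 (a p t : R) : a != 0 -> t ^+ 2 = 1 ->
  has_coframing g (kahler_eq a 0 0 0 0 0 p 0 0 0) -> g ~= g8 (t * p / a).
Proof.
move=> a0 t2 H; apply: (coframing_isog dimg).
apply: (change_coframing
  (F := fun x => vec 5 [:: co x 2; co x 3; t * co x 4; - a * co x 1;
      t * co x 5 - t * co x 2 / a + co x 2])
  (G := fun y => vec 5 [:: - co y 4 / a; co y 1; co y 2; t * co y 3;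
      t * co y 5 + co y 1 / a - t * co y 1]) _ _ _ H).
- linear_tac.
- cancel_tac_mod t2.
- lie_tac_mod t2.
Qed.

Lemma kahler_eq_isog_g6 (d : R) : d != 0 ->
  has_coframing g (kahler_eq (- 2 * d) 0 0 d 0 (- d) 0 (- d) 0 0) -> g ~= g6 R.
Proof.
move=> d0 H; apply: (coframing_isog dimg).
apply: (change_coframing
  (F := fun x => vec 5 [:: co x 2; co x 3; - co x 4 / (2 * d); d * co x 1;
      - (co x 5 + co x 2 / (2 * d)) / (2 * d)])
  (G := fun y => vec 5 [:: co y 4 / d; co y 1; co y 2; - 2 * d * co y 3;
      - 2 * d * co y 5 - co y 1 / (2 * d)]) _ _ _ H).
- linear_tac.
- cancel_tac.
- lie_tac.
Qed.

Lemma kahler_eq_isog_g6' (d : R) : d != 0 ->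
  has_coframing g (kahler_eq (2 * d) 0 0 d 0 (- d) 0 d 0 0) -> g ~= g6 R.
Proof.
move=> d0 H; apply: (coframing_isog dimg).
apply: (change_coframing
  (F := fun x => vec 5 [:: co x 2; co x 4; - co x 3 / (2 * d); - d * co x 1;
      (co x 5 - co x 2 / (2 * d)) / (2 * d)])
  (G := fun y => vec 5 [:: - co y 4 / d; co y 1; - 2 * d * co y 3; co y 2;
      2 * d * co y 5 + co y 1 / (2 * d)]) _ _ _ H).
- linear_tac.
- cancel_tac.
- lie_tac.
Qed.

Lemma kahler_eq_isog_g5 (d : R) : d != 0 ->
  has_coframing g (kahler_eq (2 * d) 0 0 d 0 d 0 d 0 0) -> g ~= g5 R.
Proof.
move=> d0 H; apply: (coframing_isog dimg).
apply: (change_coframing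
  (F := fun x => vec 5 [:: co x 3; co x 4; - co x 2 / (2 * d); - 2 * d * co x 1;
      co x 5])
  (G := fun y => vec 5 [:: - co y 4 / (2 * d); - 2 * d * co y 3; co y 1; co y 2;
      co y 5]) _ _ _ H).
- linear_tac.
- cancel_tac.
- lie_tac.
Qed.

Lemma kahler_eq_isog_g7 (d p t : R) : d != 0 -> p != 0 -> t ^+ 2 = 1 ->
  has_coframing g (kahler_eq (2 * d) 0 0 d 0 d p d 0 0) -> g ~= g7 (t * (2 * d) / p).
Proof.
move=> d0 p0 t2 H; apply: (coframing_isog dimg).
apply: (change_coframing
  (F := fun x => vec 5 [:: co x 3; t * co x 4; - t * co x 2 / (2 * d);
      - t * p * co x 1; co x 5 - co x 2 / (2 * d) + t * co x 2 / (2 * d)])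
  (G := fun y => vec 5 [:: - t * co y 4 / p; - 2 * d * t * co y 3; co y 1;
      t * co y 2; co y 5 - t * co y 3 + co y 3]) _ _ _ H).
- linear_tac.
- cancel_tac_mod t2.
- lie_tac_mod t2.
Qed.

(** The residual unitary freedom: (b, c) and (r, s) turn as vectors, d, f, h as
    the coefficients of a quadratic form. *)
Lemma rotate_e3e4 (a b c d f h p q r s k l : R) : k ^+ 2 + l ^+ 2 = 1 ->
  has_coframing g (kahler_eq a b c d f h p q r s) ->
  has_coframing g (kahler_eq a (k * b + l * c) (k * c - l * b)
    (d * k ^+ 2 + 2 * f * k * l + h * l ^+ 2)
    (f * (k ^+ 2 - l ^+ 2) + (h - d) * k * l)
    (d * l ^+ 2 - 2 * f * k * l + h * k ^+ 2)
    p q (k * r + l * s) (k * s - l * r)).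
Proof.
move=> kl1 H; have k2 : k ^+ 2 = 1 - l ^+ 2 by lra.
apply: (change_coframing
  (F := fun x => vec 5 [:: co x 1; co x 2; k * co x 3 + l * co x 4;
    k * co x 4 - l * co x 3; co x 5])
  (G := fun y => vec 5 [:: co y 1; co y 2; k * co y 3 - l * co y 4;
    k * co y 4 + l * co y 3; co y 5]) _ _ _ H).
- linear_tac.
- cancel_tac_mod k2.
- lie_tac_mod k2.
Qed.

(** When e^1 and e^4 are both closed and c = 0, the numbers a, b, d, r are the
    coefficients of a binary cubic form on the plane of e_1 and - e_4. The
    coefficients in the hypothesis are those of the form a x^3 + r y^3 written
    in axes turned by the rotation (k, l), which this lemma undoes. *)
Lemma rotate_e1e4 (a r k l : R) : k ^+ 2 + l ^+ 2 = 1 ->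
  has_coframing g (kahler_eq (k ^+ 3 * a - l ^+ 3 * r)
    (k ^+ 2 * l * a + l ^+ 2 * k * r) 0 (k * l ^+ 2 * a - l * k ^+ 2 * r) 0 0
    0 (k * l ^+ 2 * a - l * k ^+ 2 * r) (l ^+ 3 * a + k ^+ 3 * r) 0) ->
  has_coframing g (kahler_eq a 0 0 0 0 0 0 0 r 0).
Proof.
move=> kl1 H; have k2 : k ^+ 2 = 1 - l ^+ 2 by lra.
apply: (change_coframing
  (F := fun x => vec 5 [:: k * co x 1 - l * co x 4; k * co x 2 + l * co x 3;
    k * co x 3 - l * co x 2; l * co x 1 + k * co x 4; co x 5])
  (G := fun y => vec 5 [:: k * co y 1 + l * co y 4; k * co y 2 - l * co y 3;
    k * co y 3 + l * co y 2; k * co y 4 - l * co y 1; co y 5]) _ _ _ H).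
- linear_tac.
- cancel_tac_mod k2.
- lie_tac_mod k2.
Qed.

End Leaves.

(** * The Jacobi equations and the case analysis *)

Section JacobiEquations.
Variables (R : realType) (g : lieAlgType R).
Hypothesis dimg : \dim {:g} = 5%N.

Lemma coframe_bracket_kahler_eq (a b c d f h p q r s : R)
    (x1 x2 x3 x4 x5 y1 y2 y3 y4 y5 : R) :
  coframe_bracket (kahler_eq a b c d f h p q r s)
    (vec 5 [:: x1; x2; x3; x4; x5]) (vec 5 [:: y1; y2; y3; y4; y5]) =
  vec 5 [:: 0;
    - (a * (x1 * y2 - x2 * y1) + b * (x1 * y3 - x3 * y1) + c * (x1 * y4 - x4 * y1)
       - c * (x2 * y3 - x3 * y2) + b * (x2 * y4 - x4 * y2)
       + (d + h) * (x3 * y4 - x4 * y3));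
    - (b * (x1 * y2 - x2 * y1) + d * (x1 * y3 - x3 * y1) + (f + p) * (x1 * y4 - x4 * y1)
       - f * (x2 * y3 - x3 * y2) + (q - h) * (x2 * y4 - x4 * y2)
       + r * (x3 * y4 - x4 * y3));
    - (c * (x1 * y2 - x2 * y1) + (f - p) * (x1 * y3 - x3 * y1) + h * (x1 * y4 - x4 * y1)
       + (d - q) * (x2 * y3 - x3 * y2) + f * (x2 * y4 - x4 * y2)
       + s * (x3 * y4 - x4 * y3));
    - ((x1 * y2 - x2 * y1) + (x3 * y4 - x4 * y3))].
Proof. by each_coordinate; expand_coordinates; ring. Qed.

Ltac component e :=
  rewrite /e /= !coframe_bracket_kahler_eq !coD !co_vec //=; ring.

(** The equations d^2 e^k = 0 for k = 2, 3, 4, read on triples of basis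
    vectors, in the gauge c = 0. *)
Lemma jacobi_kahler_eq (a b d f h p q r s : R) :
  has_coframing g (kahler_eq a b 0 d f h p q r s) ->
  [/\ [/\ b * (2 * f - p) = 0, b * (d + 3 * h - q) = 0,
      (d + h) ^+ 2 - a * (d + h) - b * r + b ^+ 2 = 0 & - b * s = 0],
    [/\ - a * f - d * f - d * p - f * h + 2 * f * q + h * p = 0,
      - a * h + a * q + b * r - b ^+ 2 + d * h - d * q - 2 * f * p
        - 2 * f ^+ 2 + h * q - h ^+ 2 = 0,
      - b * d - 2 * b * h + b * q - f * s + h * r - p * s = 0
    & b * f + f * r + h * s - q * s = 0],
    a * d - a * q - d * h - d * q + d ^+ 2 - 2 * f * p + 2 * f ^+ 2 + h * q = 0,
    b * f + d * s - f * r + p * r = 0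
  & - b * d + b * q - d * r - f * s + q * r = 0].
Proof.
move=> /(coframing_jacobi dimg) J.
pose e (i : nat) : 'rV[R]_5 :=
  vec 5 [:: (i == 1%N)%:R; (i == 2)%:R; (i == 3)%:R; (i == 4)%:R; 0].
have E i j k m :
    - co (let br := coframe_bracket (kahler_eq a b 0 d f h p q r s) in
    br (e i) (br (e j) (e k)) + br (e j) (br (e k) (e i))
      + br (e k) (br (e i) (e j))) m = 0.
  by rewrite [X in co X]J co0 oppr0.
split; [split|split|..].
- by apply: etrans (E 1 2 3 2)%N; component e.
- by apply: etrans (E 1 2 4 2)%N; component e.
- by apply: etrans (E 1 3 4 2)%N; component e.
- by apply: etrans (E 2 3 4 2)%N; component e.
- by apply: etrans (E 1 2 3 3)%N; component e.
- by apply: etrans (E 1 2 4 3)%N; component e.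
- by apply: etrans (E 1 3 4 3)%N; component e.
- by apply: etrans (E 2 3 4 3)%N; component e.
- by apply: etrans (E 1 2 3 4)%N; component e.
- by apply: etrans (E 1 3 4 4)%N; component e.
- by apply: etrans (E 2 3 4 4)%N; component e.
Qed.

End JacobiEquations.

Lemma diagonalizing_rotation (R : realType) (P Q : R) :
  exists k l : R, k ^+ 2 + l ^+ 2 = 1 /\ P * (k ^+ 2 - l ^+ 2) + Q * k * l = 0.
Proof.
have [->|P0] := eqVneq P 0; first by exists 1, 0; split; ring.
have D0 : 0 <= Q ^+ 2 + 4 * P ^+ 2 by nra.
pose t := (Q + Num.sqrt (Q ^+ 2 + 4 * P ^+ 2)) / (2 * P).
have tE : P * t ^+ 2 - Q * t - P = 0.
  have E := sqr_sqrtr D0; rewrite /t; move: (Num.sqrt _) E => u E.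
  by field: E; rewrite P0.
have T0 : 0 <= 1 + t ^+ 2 by nra.
have T1 : Num.sqrt (1 + t ^+ 2) != 0 by rewrite gt_eqF // sqrtr_gt0; nra.
have E := sqr_sqrtr T0; move: (Num.sqrt _) T1 E => u u0 E.
exists u^-1, (t / u); split; first by field: E.
have -> : P * (u^-1 ^+ 2 - (t / u) ^+ 2) + Q * u^-1 * (t / u)
   = - (P * t ^+ 2 - Q * t - P) / u ^+ 2 by field.
by rewrite tE oppr0 mul0r.
Qed.

Lemma orthogonalizing_rotation (R : realType) (b c : R) :
  exists k l : R, k ^+ 2 + l ^+ 2 = 1 /\ k * c - l * b = 0.
Proof.
have [c0|c0] := eqVneq c 0; first by exists 1, 0; rewrite c0; split; ring.
have T0 : 0 <= b ^+ 2 + c ^+ 2 by nra.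
have T1 : Num.sqrt (b ^+ 2 + c ^+ 2) != 0.
  by rewrite gt_eqF // sqrtr_gt0 ltr_wpDl ?sqr_ge0 // exprn_even_gt0.
have E := sqr_sqrtr T0; move: (Num.sqrt _) T1 E => u u0 E.
by exists (b / u), (c / u); split; [field: E | field].
Qed.

Lemma sqr_norm_neq0 (R : realType) (x y : R) :
  (x != 0) || (y != 0) -> x ^+ 2 + y ^+ 2 != 0.
Proof.
by rewrite paddr_eq0 ?sqr_ge0 // !expf_eq0 /= negb_and.
Qed.

Lemma exists_sign (R : realType) (x : R) :
  x != 0 -> exists2 t : R, t ^+ 2 = 1 & 0 < t * x.
Proof.
case: (ltgtP x 0) => // x0 _; first
  by exists (-1); [ring | rewrite mulN1r oppr_gt0].
by exists 1; [ring | rewrite mul1r].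
Qed.

Section Classification.
Variables (R : realType) (g : lieAlgType R).
Hypothesis dimg : \dim {:g} = 5%N.

Definition classified : Prop :=
  g ~= g1 R \/ g ~= g2 R \/ g ~= g3 R \/ g ~= g4 R \/ g ~= g5 R \/
  g ~= g6 R \/ (exists delta : R, 0 < delta /\ g ~= g7 delta) \/
  (exists delta : R, 0 < delta /\ g ~= g8 delta).

(** Here the Kaehler quotient is a product of two Lie algebras of dimension 2,
    each of them abelian or isomorphic to aff(R). *)
Lemma classify_product (a r s : R) :
  has_coframing g (kahler_eq a 0 0 0 0 0 0 0 r s) -> classified.
Proof.
have [->|a0] := eqVneq a 0; have [/andP[/eqP -> /eqP ->]|] := boolP ((r == 0) && (s == 0)).
- by move/(kahler_eq_isog_g1 dimg); rewrite /classified; tauto.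
- rewrite negb_and => /sqr_norm_neq0 /(kahler_eq_isog_g2 dimg) H /H.
  by rewrite /classified; tauto.
- by move/(kahler_eq_isog_g2_flat dimg a0); rewrite /classified; tauto.
- rewrite negb_and => /sqr_norm_neq0 /(kahler_eq_isog_g4 dimg a0) H /H.
  by rewrite /classified; tauto.
Qed.

(** The relation says that the symmetric matrices with rows (a, b), (b, d) and
    (b, d), (d, r) commute, which is all that remains of the Jacobi identity
    when e^1 and e^4 are closed. They are the two slices of a symmetric cubic
    tensor, so a common orthonormal eigenbasis turns the cubic form into
    a' x^3 + r' y^3, and the quotient becomes a product. *)
Lemma classify_two_closed (a b d r : R) : a * d + b * r = b ^+ 2 + d ^+ 2 ->
  has_coframing g (kahler_eq a b 0 d 0 0 0 d r 0) -> classified.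
Proof.
move=> comm H.
(* A rotation diagonalizing the non-scalar one of the two matrices also
   diagonalizes the other. *)
have [k [l [kl1 [m1 m4] ] ] ] : exists k l, k ^+ 2 + l ^+ 2 = 1 /\
    (b * (k ^+ 2 - l ^+ 2) + (d - a) * k * l = 0 /\
     d * (k ^+ 2 - l ^+ 2) + (r - b) * k * l = 0).
  have [b0|b0] := eqVneq b 0.
    have [da|da] := eqVneq d a.
      have [k [l [kl1 m4] ] ] := diagonalizing_rotation d (r - b).
      by exists k, l; split=> //; split=> //; rewrite b0 da; ring.
    have d0 : d = 0.
      have := comm; rewrite b0 => e.
      have /eqP : d * (d - a) = 0 by lra.
      by rewrite mulf_eq0 subr_eq0 (negPf da) orbF => /eqP.
    exists 1, 0; rewrite b0 d0; split; first by ring.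
    by split; ring.
  have [k [l [kl1 m1] ] ] := diagonalizing_rotation b (d - a).
  exists k, l; split=> //; split=> //; apply: (mulfI b0); rewrite mulr0.
  have e : b * r = b ^+ 2 + d ^+ 2 - a * d by lra.
  have -> : b * (d * (k ^+ 2 - l ^+ 2) + (r - b) * k * l) =
    d * (b * (k ^+ 2 - l ^+ 2) + (d - a) * k * l) by ring: e.
  by rewrite m1 mulr0.
pose a' := k ^+ 3 * a + 3 * k ^+ 2 * l * b + 3 * k * l ^+ 2 * d + l ^+ 3 * r.
pose r' := k ^+ 3 * r - 3 * k ^+ 2 * l * d + 3 * k * l ^+ 2 * b - l ^+ 3 * a.
(* b' and d' are the mixed coefficients of the cubic form in the rotated axes,
   a' and r' the pure ones; a, b, d, r are then recovered by rotating back. *)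
pose b' := k * (b * (k ^+ 2 - l ^+ 2) + (d - a) * k * l)
  + l * (d * (k ^+ 2 - l ^+ 2) + (r - b) * k * l).
pose d' := k * (d * (k ^+ 2 - l ^+ 2) + (r - b) * k * l)
  - l * (b * (k ^+ 2 - l ^+ 2) + (d - a) * k * l).
have b'0 : b' = 0 by rewrite /b' m1 m4 !mulr0 addr0.
have d'0 : d' = 0 by rewrite /d' m1 m4 !mulr0 subr0.
have unit3 z : z = z * (k ^+ 2 + l ^+ 2) ^+ 3 by rewrite kl1 expr1n mulr1.
have ea : a = k ^+ 3 * a' - l ^+ 3 * r'.
  transitivity (k ^+ 3 * a' - 3 * k ^+ 2 * l * b' + 3 * k * l ^+ 2 * d' - l ^+ 3 * r').
    by rewrite [LHS]unit3 /a' /b' /d' /r'; ring.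
  by rewrite b'0 d'0; ring.
have eb : b = k ^+ 2 * l * a' + l ^+ 2 * k * r'.
  transitivity (k ^+ 2 * l * a' + (k ^+ 3 - 2 * k * l ^+ 2) * b'
      + (l ^+ 3 - 2 * k ^+ 2 * l) * d' + l ^+ 2 * k * r').
    by rewrite [LHS]unit3 /a' /b' /d' /r'; ring.
  by rewrite b'0 d'0; ring.
have ed : d = k * l ^+ 2 * a' - l * k ^+ 2 * r'.
  transitivity (k * l ^+ 2 * a' + (2 * k ^+ 2 * l - l ^+ 3) * b'
      + (k ^+ 3 - 2 * k * l ^+ 2) * d' - l * k ^+ 2 * r').
    by rewrite [LHS]unit3 /a' /b' /d' /r'; ring.
  by rewrite b'0 d'0; ring.
have er : r = l ^+ 3 * a' + k ^+ 3 * r'.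
  transitivity (l ^+ 3 * a' + 3 * k * l ^+ 2 * b' + 3 * k ^+ 2 * l * d' + k ^+ 3 * r').
    by rewrite [LHS]unit3 /a' /b' /d' /r'; ring.
  by rewrite b'0 d'0; ring.
apply: (@classify_product a' r' 0); apply: rotate_e1e4 kl1 _.
by rewrite -ea -eb -ed -er.
Qed.

(** Here d e^3 and d e^4 describe a rotation of the plane of e_3 and e_4 by the
    form p e^1 + q e^2, which is closed because q a = 0. *)
Lemma classify_plane_rotation (a p q : R) : q * a = 0 ->
  has_coframing g (kahler_eq a 0 0 0 0 0 p q 0 0) -> classified.
Proof.
have [->|a0] := eqVneq a 0.
  have [/andP[/eqP -> /eqP ->] _|] := boolP ((p == 0) && (q == 0)).
    exact: classify_product.
  rewrite negb_and => /sqr_norm_neq0 N0 _ /(kahler_eq_isog_g3 dimg N0).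
  by rewrite /classified; tauto.
move/eqP; rewrite mulf_eq0 (negPf a0) orbF => /eqP ->.
have [->|p0] := eqVneq p 0; first exact: classify_product.
have [t t1 tpos] : exists2 t : R, t ^+ 2 = 1 & 0 < t * (p / a).
  by apply: exists_sign; rewrite mulf_neq0 ?invr_eq0.
move/(kahler_eq_isog_g8 dimg a0 t1) => H.
have : exists delta : R, 0 < delta /\ g ~= g8 delta.
  by exists (t * p / a); rewrite -mulrA; rewrite -mulrA in H.
by rewrite /classified; tauto.
Qed.

(** In the gauge b = c = f = 0 the Jacobi equations factor, and each choice of
    vanishing factors leaves one of the listed algebras or a family already
    treated. *)
Lemma classify_reduced (a d h p q r s : R) :
  has_coframing g (kahler_eq a 0 0 d 0 h p q r s) -> classified.
Proof.
move=> H; have [] := jacobi_kahler_eq dimg H.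
move=> [_ _ J1 _] [J2 J3 J4 J5] J6 J7 J8.
have {}J1 : (d + h) * (d + h - a) = 0 by lra.
have {}J2 : p * (h - d) = 0 by lra.
have {}J3 : (q - h) * (a - d + h) = 0 by lra.
have {}J4 : h * r = p * s by lra.
have {}J5 : s * (h - q) = 0 by lra.
have {}J6 : (d - q) * (a + d - h) = 0 by lra.
have {}J7 : d * s = - p * r by lra.
have {}J8 : r * (q - d) = 0 by lra.
have [dh|dh] := eqVneq (d + h) 0.
  have hd : h = - d by lra.
  move: J2 J3 J4 J5 J6 J7 J8 H; rewrite hd => {J1 dh hd h}.
  have [->|d0] := eqVneq d 0.
    rewrite oppr0 !(subr0, addr0, sub0r, mul0r) => _ J3 J4 J5 _ J7 J8 H.
    have [/andP[/eqP r0 /eqP s0]|] := boolP ((r == 0) && (s == 0)).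
      by move: H; rewrite r0 s0; exact: classify_plane_rotation.
    rewrite negb_and => rs.
    have [p0 q0] : p = 0 /\ q = 0.
      have N0 := sqr_norm_neq0 rs.
      by split; apply: (mulfI N0); nra.
    by move: H; rewrite p0 q0; exact: classify_product.
  have d2 : 2 * d != 0 by rewrite mulf_neq0 ?pnatr_eq0.
  move=> J2 J3 J4 J5 J6 J7 J8.
  have p0 : p = 0 by apply: (mulfI d2); lra.
  rewrite p0 mul0r oppr0 mul0r in J4 J7 *.
  have r0 : r = 0 by apply: (mulfI d0); lra.
  have s0 : s = 0 by apply: (mulfI d0); lra.
  rewrite r0 s0.
  have [qd|qd] := eqVneq q (- d).
    rewrite qd; have -> : a = - 2 * d by apply: (mulfI d2); move: J6; rewrite qd; lra.
    by move/(kahler_eq_isog_g6 dimg d0); rewrite /classified; tauto.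
  have q0 : q + d != 0 by rewrite addr_eq0.
  have a2 : a = 2 * d by apply: (mulfI q0); lra.
  have -> : q = d by apply: (mulfI d2); move: J6; rewrite a2; lra.
  by rewrite a2 => /(kahler_eq_isog_g6' dimg d0); rewrite /classified; tauto.
have aE : a = d + h by apply: (mulfI dh); lra.
move: J3 J6 H; rewrite aE => J3 J6 H.
(* If d or h vanishes then e^3 or e^4 is closed, and the frame falls in the case
   of two closed forms, after exchanging e^3 and e^4 if need be. *)
have [d0|d0] := eqVneq d 0.
  have h0 : h != 0 by move: dh; rewrite d0 add0r.
  have qh : q = h by apply: (mulfI h0); move: J3; rewrite d0; lra.
  have p0 : p = 0 by apply: (mulfI h0); move: J2; rewrite d0; lra.
  have r0 : r = 0 by apply: (mulfI h0); rewrite J4 p0; ring.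
  move: H; rewrite d0 qh p0 r0 add0r => H.
  have kl1 : (0 : R) ^+ 2 + 1 ^+ 2 = 1 by ring.
  apply: (@classify_two_closed h 0 h s); first by ring.
  move: (rotate_e3e4 kl1 H).
  by rewrite !(expr0n, expr1n, mul0r, mulr0, mul1r, mulr1, addr0, add0r, subr0, sub0r, oppr0).
have [h0|h0] := eqVneq h 0.
  have qd : q = d by apply: (mulfI d0); move: J6; rewrite h0; lra.
  have p0 : p = 0 by apply: (mulfI d0); move: J2; rewrite h0; lra.
  have s0 : s = 0 by apply: (mulfI d0); rewrite J7 p0; ring.
  move: H; rewrite h0 qd p0 s0 addr0.
  by apply: classify_two_closed; ring.
have qh : q = h by apply: (mulfI h0); lra.
have qd : q = d by apply: (mulfI d0); lra.
have hd : h = d by rewrite -qh.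
have r0 : r = 0.
  have N0 := sqr_norm_neq0 (introT orP (or_introl d0) : (d != 0) || (p != 0)).
  apply: (mulfI N0); rewrite hd in J4; rewrite mulr0.
  transitivity (d * (d * r - p * s) + p * (d * s + p * r)); first by ring.
  by rewrite J4 J7; ring.
have s0 : s = 0 by apply: (mulfI d0); rewrite J7 r0; ring.
have dhE : d + h = 2 * d by rewrite hd; ring.
move: H; rewrite dhE qd hd r0 s0.
have [->|p0] := eqVneq p 0.
  by move/(kahler_eq_isog_g5 dimg d0); rewrite /classified; tauto.
have [t t1 tpos] : exists2 t : R, t ^+ 2 = 1 & 0 < t * (2 * d / p).
  by apply: exists_sign; rewrite !mulf_neq0 ?invr_eq0 ?pnatr_eq0.
move/(kahler_eq_isog_g7 dimg d0 p0 t1) => H.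
have : exists delta : R, 0 < delta /\ g ~= g7 delta.
  by exists (t * (2 * d) / p); rewrite -mulrA; rewrite -mulrA in H.
by rewrite /classified; tauto.
Qed.

(** A rotation of (e^3, e^4) achieves c = 0. If b is then nonzero, the Jacobi
    equations leave only the case of two closed forms; otherwise (b, c) = 0 is
    preserved by a second rotation, which diagonalizes the quadratic form. *)
Lemma classify_kahler (a b c d f h p q r s : R) :
  has_coframing g (kahler_eq a b c d f h p q r s) -> classified.
Proof.
have [k [l [kl1 c0] ] ] := orthogonalizing_rotation b c.
move/(rotate_e3e4 kl1); rewrite c0.
move: (k * b + _) (d * _ + _ + _) (f * _ + _) (d * _ - _ + _) (k * r + _) (k * s - _).
move=> {}b {}d {}f {}h {}r {}s {k l kl1 c0 c} H.
have [b0|b0] := eqVneq b 0.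
  have [k [l [kl1 f0] ] ] := diagonalizing_rotation f (h - d).
  move: (rotate_e3e4 kl1 H); rewrite f0 b0 !mulr0 addr0 subr0.
  exact: classify_reduced.
have [ [J1 J2 J3 J4] [J5 J6 J7 J8] J9 J10 J11] := jacobi_kahler_eq dimg H.
have s0 : s = 0 by apply: (mulfI b0); lra.
have pE : p = 2 * f by apply: (mulfI b0); lra.
have qE : q = d + 3 * h by apply: (mulfI b0); lra.
have [f0 h0] : f = 0 /\ h = 0.
  move: J5 J6 J7 J8 J9 J10 J11; rewrite s0 pE qE => J5 J6 J7 J8 J9 J10 J11.
  (* For r = - b, a nonzero f would give a + d = 7 h by J5, and then
     f^2 + 9 h^2 = 0 by J9. *)
  have [rb|rb] := eqVneq (b + r) 0.
    have rE : r = - b by lra.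
    rewrite rE in J3 J6.
    have f0 : f = 0.
      apply/eqP/negP => /negP f0.
      have ad : a + d = 7 * h by apply: (mulfI f0); lra.
      have e : f ^+ 2 + 9 * h ^+ 2 = 0 by nra.
      have f2 : 0 < f ^+ 2 by rewrite exprn_even_gt0.
      have h2 := sqr_ge0 h; lra.
    by split=> //; move: J3 J6 J9; rewrite f0 => J3 J6 J9; nra.
  by split; apply: (mulfI rb); lra.
move: H; rewrite s0 pE qE f0 h0 !mulr0 addr0.
apply: classify_two_closed.
by move: J3; rewrite h0; lra.
Qed.

End Classification.

(** * Unitary frames of a Sasakian Lie algebra *)

Section Sasakian.
Variables (R : realType) (g : lieAlgType R) (S : sasakian g).

Let J := sas_Phi S.
Let alpha := sas_alpha S.
Let xi := sas_xi S.
Let m := sas_metric S.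

Let mC x y : m x y = m y x.
Proof. by rewrite /m hermC /= expr0 mul1r. Qed.

Let mDr z x y : m z (x + y) = m z x + m z y. Proof. exact: linearDr. Qed.
Let mNr z x : m z (- x) = - m z x. Proof. exact: linearNr. Qed.
Let mZr z a x : m z (a *: x) = a * m z x. Proof. by rewrite /m linearZr_LR. Qed.
Let mDl z x y : m (x + y) z = m x z + m y z. Proof. by rewrite mC mDr !(mC z). Qed.
Let mNl z x : m (- x) z = - m x z. Proof. by rewrite mC mNr (mC z). Qed.
Let mZl z a x : m (a *: x) z = a * m x z. Proof. by rewrite mC mZr (mC z). Qed.

Let m_eq0 x : m x x = 0 -> x = 0.
Proof.
by move=> mx; apply/eqP; apply: contra_eqT mx => /neq0_dnorm_gt0 /gt_eqF ->.
Qed.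

Let alpha_xi : alpha xi = 1. Proof. exact: sas_alpha_xi. Qed.
Let JJ x : J (J x) = - x + alpha x *: xi. Proof. exact: sas_PhiK. Qed.
Let mJJ x y : m (J x) (J y) = m x y - alpha x * alpha y.
Proof. exact: sas_metric_Phi. Qed.
Let JD x y : J (x + y) = J x + J y. Proof. exact: linearD. Qed.
Let JN x : J (- x) = - J x. Proof. exact: linearN. Qed.
Let JZ a x : J (a *: x) = a *: J x. Proof. exact: linearZ. Qed.
Let aD x y : alpha (x + y) = alpha x + alpha y. Proof. exact: linearD. Qed.
Let aZ a x : alpha (a *: x) = a * alpha x. Proof. exact: linearZ. Qed.

Lemma Phi_xi : J xi = 0.
Proof.
have JJxi : J (J xi) = 0 by rewrite JJ alpha_xi scale1r addNr.
have E : alpha (J xi) *: xi = J xi.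
  have := JJ (J xi); rewrite JJxi linear0 => /esym/eqP.
  by rewrite addrC subr_eq0 => /eqP.
have : alpha (J xi) *: J xi = 0 by rewrite -JZ E JJxi.
move/eqP; rewrite scaler_eq0 => /orP[/eqP a0|/eqP //].
by rewrite -E a0 scale0r.
Qed.

Lemma metric_xi x : m xi x = alpha x.
Proof.
have := mJJ xi x; rewrite Phi_xi alpha_xi mul1r.
by rewrite mC /m linear0r => /esym/eqP; rewrite subr_eq0 => /eqP.
Qed.

Lemma alpha_Phi x : alpha (J x) = 0.
Proof.
have : alpha (J x) *: xi = 0.
  have := JJ (J x); rewrite [J (J x)]JJ JD JN JZ Phi_xi scaler0 addr0.
  by rewrite -[LHS]addr0 => /addrI.
move/eqP; rewrite scaler_eq0 => /orP[/eqP //|/eqP xi0].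
by have := alpha_xi; rewrite xi0 linear0 => /esym/eqP; rewrite oner_eq0.
Qed.

Lemma metric_Phi x y : m (J x) y = - m x (J y).
Proof.
have := mJJ x (J y); rewrite alpha_Phi mulr0 subr0 JJ mDr mNr mZr.
by rewrite (mC _ xi) metric_xi alpha_Phi mulr0 addr0 => <-; rewrite opprK.
Qed.

Lemma alpha_lie x y : alpha [[x, y]] = 2 * m (J x) y.
Proof.
by have := sas_metric_dalpha S x y; rewrite /dform metric_Phi mulrN => ->; rewrite opprK.
Qed.

(** A central z satisfies 0 = alpha [z, J z] = 2 |J z|^2, hence is a multiple of
    the Reeb vector xi, since J is an isometry on the orthogonal of xi. *)
Lemma xi_central : nontrivial_center g -> in_center xi.
Proof.
move=> [z zc z0].
have E : m z z = alpha z ^+ 2.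
  have : m (J z) (J z) = 0.
    by have := alpha_lie z (J z); rewrite zc linear0; lra.
  by rewrite mJJ; lra.
have zE : z = alpha z *: xi.
  apply/eqP; rewrite -subr_eq0; apply/eqP/m_eq0.
  rewrite !(mDl, mDr, mNl, mNr, mZl, mZr) metric_xi (mC z xi) metric_xi.
  by rewrite metric_xi alpha_xi E; ring.
have az0 : alpha z != 0 by apply: contraNneq z0 => a0; rewrite zE a0 scale0r.
move=> x; apply/eqP; have := zc x; rewrite zE lieC lieZr -scalerN -lieC => /eqP.
by rewrite scaler_eq0 (negPf az0).
Qed.

Lemma unit_multiple x : x != 0 -> exists2 a, a != 0 & m (a *: x) (a *: x) = 1.
Proof.
move=> x0; have mx : 0 < m x x by apply: neq0_dnorm_gt0.
exists (Num.sqrt (m x x))^-1; first by rewrite invr_eq0 gt_eqF // sqrtr_gt0.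
rewrite mZl mZr; have E := sqr_sqrtr (ltW mx).
have : Num.sqrt (m x x) != 0 by rewrite gt_eqF // sqrtr_gt0.
by move: (Num.sqrt _) E => s E s0; rewrite -E; field.
Qed.

(** Unit vectors u, v of the kernel of alpha such that u, J u, v, J v are
    orthonormal; the remaining orthogonality relations follow. *)
Definition unitary_frame u v : Prop :=
  [/\ m u u = 1, m v v = 1, alpha u = 0, alpha v = 0 & m u v = 0 /\ m (J u) v = 0].

Hypothesis dimg : \dim {:g} = 5%N.

Lemma exists_unitary_frame u : m u u = 1 -> alpha u = 0 ->
  exists v, unitary_frame u v.
Proof.
move=> uu au.
have [||v v0 /rowP E] := @nontrivial_kernel _ g 3
    (fun x => vec 3 [:: alpha x; m u x; m (J u) x]).
- by move=> a x y; each_coordinate; rewrite !(coD, coZ) !co_vec //= ?aD ?aZ ?mDr ?mZr.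
- by rewrite dimg.
have [av uv Juv] : [/\ alpha v = 0, m u v = 0 & m (J u) v = 0].
  by split; [have := E 0 | have := E 1 | have := E 2%R]; rewrite !mxE.
have [a a0 vv] := unit_multiple v0.
by exists (a *: v); split=> //; rewrite ?aZ ?mZr ?av ?uv ?Juv ?mulr0.
Qed.

Hypothesis xi_center : in_center xi.

Section Frame.
Variables u v : g.
Hypothesis uv : unitary_frame u v.

Let frame_products :
  [/\ [/\ m u u = 1, m (J u) (J u) = 1, m v v = 1 & m (J v) (J v) = 1],
      [/\ m u (J u) = 0, m u v = 0, m u (J v) = 0, m (J u) v = 0 & m (J u) (J v) = 0],
      m v (J v) = 0,
      [/\ m u xi = 0, m (J u) xi = 0, m v xi = 0 & m (J v) xi = 0]
    & [/\ alpha u = 0, alpha (J u) = 0, alpha v = 0 & alpha (J v) = 0] ].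
Proof.
have [uu vv au av [uv0 Juv] ] := uv.
have skew x : m x (J x) = 0 by have := metric_Phi x x; rewrite (mC (J x)); lra.
split; [split|split| |split|split]; rewrite ?alpha_Phi ?(mC _ xi) ?metric_xi ?alpha_Phi //.
- by rewrite mJJ uu au; ring.
- by rewrite mJJ vv av; ring.
- by have := metric_Phi u v; rewrite Juv; lra.
- by rewrite mJJ uv0 au; ring.
Qed.

Lemma frame_expansion x :
  x = m u x *: u + m (J u) x *: J u + m v x *: v + m (J v) x *: J v + alpha x *: xi.
Proof.
pose F (c : 'rV[R]_5) := co c 1 *: u + co c 2 *: J u + co c 3 *: v + co c 4 *: J v
  + co c 5 *: xi.
pose t x := vec 5 [:: m u x; m (J u) x; m v x; m (J v) x; alpha x].
have [ [e1 e2 e3 e4] [e5 e6 e7 e8 e9] e10 [f1 f2 f3 f4] [f5 f6 f7 f8] ] := frame_products.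
have Ft c : t (F c) = c.
  each_coordinate; rewrite co_vec //= /F ?aD ?aZ ?mDr ?mZr.
  - by rewrite e1 e5 e6 e7 f1; ring.
  - by rewrite (mC _ u) e2 e5 e8 e9 f2; ring.
  - by rewrite (mC _ u) (mC _ (J u)) e6 e8 e3 e10 f3; ring.
  - by rewrite (mC _ u) (mC _ (J u)) (mC _ v) e7 e9 e10 e4 f4; ring.
  - by rewrite f5 f6 f7 f8 alpha_xi; ring.
have linF : linear F.
  move=> a c d; rewrite /F !coD !coZ !scalerDl -!scalerA !scalerDr.
  by rewrite !(addrACA _ (a *: _)) -!addrA.
pose Fl := HB.pack_for {linear 'rV[R]_5 -> g} F
  (GRing.isLinear.Build _ _ _ _ F linF).
have [|G GF FG] := inj_linear_bij (f := Fl) (can_inj Ft).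
  by rewrite dimg dimvf /dim /= mul1n.
have : F (t x) = x by rewrite -[x]FG /= Ft.
by rewrite /F !co_vec.
Qed.

Lemma frame_linear (F : g -> R) : linear_for *%R F -> forall x,
  F x = m u x * F u + m (J u) x * F (J u) + m v x * F v + m (J v) x * F (J v)
    + alpha x * F xi.
Proof.
move=> linF x.
have F0 : F 0 = 0 by have := linF 1 0 0; rewrite scale1r addr0; lra.
have FZ a y : F (a *: y) = a * F y by rewrite -[a *: y]addr0 linF F0 addr0.
have FD y z : F (y + z) = F y + F z by rewrite -[y]scale1r linF mul1r scale1r.
by rewrite [in LHS](frame_expansion x) !FD !FZ.
Qed.

Lemma frame_lie (F : g -> R) : linear_for *%R F -> forall x y,
  F [[x, y]] =
    (m u x * m (J u) y - m (J u) x * m u y) * F [[u, J u]]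
  + (m u x * m v y - m v x * m u y) * F [[u, v]]
  + (m u x * m (J v) y - m (J v) x * m u y) * F [[u, J v]]
  + (m (J u) x * m v y - m v x * m (J u) y) * F [[J u, v]]
  + (m (J u) x * m (J v) y - m (J v) x * m (J u) y) * F [[J u, J v]]
  + (m v x * m (J v) y - m (J v) x * m v y) * F [[v, J v]].
Proof.
move=> linF x y.
have F0 : F 0 = 0 by have := linF 1 0 0; rewrite scale1r addr0; lra.
have FC p q : F [[p, q]] = - F [[q, p]].
  by have := linF (-1) [[q, p]] 0; rewrite addr0 F0 scaleN1r -lieC; lra.
have linl z : linear_for *%R (fun t => F [[t, z]]).
  by move=> a p q /=; rewrite lie_linearl linF.
have linr z : linear_for *%R (fun t => F [[z, t]]).
  by move=> a p q /=; rewrite lie_linearr linF.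
have Fxi z : F [[xi, z]] = 0 by rewrite xi_center.
have Fxx z : F [[z, z]] = 0 by rewrite liexx.
have E z : F [[z, y]] = m u y * F [[z, u]] + m (J u) y * F [[z, J u]]
   + m v y * F [[z, v]] + m (J v) y * F [[z, J v]].
  by rewrite (frame_linear (linr z) y) (FC z xi) Fxi oppr0 mulr0 addr0.
rewrite (frame_linear (linl y) x) Fxi !E !Fxx.
by rewrite (FC (J u) u) (FC v u) (FC (J v) u) (FC v (J u)) (FC (J v) (J u)) (FC (J v) v); ring.
Qed.

Let m_linear w : linear_for *%R (m w).
Proof. by move=> a x y; rewrite mDr mZr. Qed.

Let frame_lie_r w x z : m w [[x, z]] =
  m u z * m w [[x, u]] + m (J u) z * m w [[x, J u]] + m v z * m w [[x, v]]
    + m (J v) z * m w [[x, J v]].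
Proof.
have lin : linear_for *%R (fun z => m w [[x, z]]).
  by move=> a p q /=; rewrite lie_linearr m_linear.
by rewrite (frame_linear lin) (lieC x xi) xi_center oppr0 /m linear0r mulr0 addr0.
Qed.

Definition trace_form x :=
  m u [[x, u]] + m (J u) [[x, J u]] + m v [[x, v]] + m (J v) [[x, J v]].

Lemma trace_form_linear : linear_for *%R trace_form.
Proof. by move=> a x y; rewrite /trace_form !lie_linearl !m_linear; ring. Qed.

(** The trace of ad vanishes on brackets, being the trace of a commutator. *)
Lemma trace_form_lie x y : trace_form [[x, y]] = 0.
Proof.
have ad w : m w [[ [[x, y]], w]] = m w [[x, [[y, w]]]] - m w [[y, [[x, w]]]].
  have := congr1 (m w) (lie_jacobi x y w).
  rewrite /m linear0r -/m !mDr (lieC w [[x, y]]) (lieC w x) lieNr !mNr; lra.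
rewrite /trace_form !ad.
have E w z1 z2 := frame_lie_r w z1 [[z2, w]].
by rewrite !E; ring.
Qed.

(** For the 1-form eta = <t, .> on the Kaehler quotient the left-hand side is the
    coefficient of d eta /\ d eta = d (eta /\ d eta), up to a factor 2, and
    d vanishes on 3-forms of a unimodular Lie algebra of dimension 4. *)
Lemma unimodular_pfaffian t : alpha t = 0 -> (forall x, trace_form x = 0) ->
  m t [[u, J u]] * m t [[v, J v]] - m t [[u, v]] * m t [[J u, J v]]
    + m t [[u, J v]] * m t [[J u, v]] = 0.
Proof.
move=> at0 th0.
have g1 : [[J u, u]] = - [[u, J u]] by apply: lieC.
have g2 : [[v, u]] = - [[u, v]] by apply: lieC.
have g3 : [[J v, u]] = - [[u, J v]] by apply: lieC.
have g4 : [[v, J u]] = - [[J u, v]] by apply: lieC.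
have g5 : [[J v, J u]] = - [[J u, J v]] by apply: lieC.
have g6 : [[J v, v]] = - [[v, J v]] by apply: lieC.
have m0 x : m x 0 = 0 by exact: linear0r.
have mt z : m t z = m u z * m t u + m (J u) z * m t (J u) + m v z * m t v
    + m (J v) z * m t (J v).
  by rewrite (frame_linear (m_linear t) z) (mC t xi) metric_xi at0 mulr0 addr0.
have jac x y z : m t [[x, [[y, z]]]] + m t [[y, [[z, x]]]] + m t [[z, [[x, y]]]] = 0.
  by rewrite -!mDr lie_jacobi m0.
have nest x y z := frame_lie_r t x [[y, z]].
have t1 := th0 u; have t2 := th0 (J u); have t3 := th0 v; have t4 := th0 (J v).
have j1 := jac (J u) v (J v); have j2 := jac u v (J v).
have j3 := jac u (J u) (J v); have j4 := jac u (J u) v.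
rewrite /trace_form !liexx ?(g1, g2, g3, g4, g5, g6) ?m0 ?mNr in t1 t2 t3 t4.
rewrite !nest !liexx ?(g1, g2, g3, g4, g5, g6) ?m0 ?mNr in j1 j2 j3 j4.
(* tau is eta /\ d eta; d tau is a combination of traces times coefficients of
   tau and of d (d eta) = 0 times those of eta. *)
pose tau x y z := m t x * m t [[y, z]] - m t y * m t [[x, z]] + m t z * m t [[x, y]].
apply: (mulfI (_ : 2 != 0 :> R)); first by rewrite pnatr_eq0.
have comb a1 a2 a3 a4 b1 b2 b3 b4 p1 p2 p3 p4 q1 q2 q3 q4 :
    p1 = 0 -> p2 = 0 -> p3 = 0 -> p4 = 0 -> q1 = 0 -> q2 = 0 -> q3 = 0 -> q4 = 0 ->
    a1 * p1 - a2 * p2 + a3 * p3 - a4 * p4 - b1 * q1 + b2 * q2 - b3 * q3 + b4 * q4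
      = 2 * 0 :> R.
  by move=> -> -> -> -> -> -> -> ->; ring.
apply: etrans (comb (tau (J u) v (J v)) (tau u v (J v)) (tau u (J u) (J v)) (tau u (J u) v)
  (m t u) (m t (J u)) (m t v) (m t (J v)) _ _ _ _ _ _ _ _ t1 t2 t3 t4 j1 j2 j3 j4).
rewrite /tau (mt [[u, J u]]) (mt [[u, v]]) (mt [[u, J v]]) (mt [[J u, v]])
  (mt [[J u, J v]]) (mt [[v, J v]]).
clear; ring.
Qed.

(** A nonzero 1-form of the Kaehler quotient vanishing on all brackets. If the
    quotient is not unimodular, the trace of ad is one. Otherwise the self-dual
    2-forms have dimension 3, so some nonzero eta among the four-dimensional
    space of 1-forms has an anti-self-dual differential; since the square of
    an anti-self-dual form is minus its squared norm times the volume form,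
    d eta /\ d eta = 0 gives d eta = 0. *)
Lemma exists_closed_form :
  exists w, [/\ w != 0, alpha w = 0 & forall x y, m w [[x, y]] = 0].
Proof.
have [ [e1 e2 e3 e4] [e5 e6 e7 e8 e9] e10 [f1 f2 f3 f4] [f5 f6 f7 f8] ] := frame_products.
have th_xi : trace_form xi = 0.
  by rewrite /trace_form !xi_center /m !linear0r; ring.
pose w := trace_form u *: u + trace_form (J u) *: J u + trace_form v *: v
  + trace_form (J v) *: J v.
have thE x : m w x = trace_form x.
  by rewrite (frame_linear trace_form_linear x) th_xi /w !mDl !mZl; ring.
have [w0|w0] := eqVneq w 0; last first.
  exists w; split=> // [|x y]; last by rewrite thE trace_form_lie.
  by rewrite /w !aD !aZ f5 f6 f7 f8; ring.
have th0 x : trace_form x = 0 by rewrite -thE w0 /m linear0l.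
have [||t t0 /rowP E] := @nontrivial_kernel _ g 4
    (fun x => vec 4 [:: alpha x; m x [[u, J u]] + m x [[v, J v]];
      m x [[u, v]] - m x [[J u, J v]]; m x [[u, J v]] + m x [[J u, v]] ]).
- move=> a x y; each_coordinate; rewrite !(coD, coZ) !co_vec //= ?aD ?aZ ?mDl ?mZl //; ring.
- by rewrite dimg.
have [at0 s1 s2 s3] : [/\ alpha t = 0, m t [[u, J u]] + m t [[v, J v]] = 0,
    m t [[u, v]] - m t [[J u, J v]] = 0 & m t [[u, J v]] + m t [[J u, v]] = 0].
  by split; [have := E 0 | have := E 1 | have := E 2%R | have := E 3%R]; rewrite !mxE.
exists t; split=> //.
have pf : m t [[u, J u]] * m t [[v, J v]] - m t [[u, v]] * m t [[J u, J v]]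
    + m t [[u, J v]] * m t [[J u, v]] = 0 by exact: unimodular_pfaffian.
have [z1 z2 z3] : [/\ m t [[u, J u]] = 0, m t [[u, v]] = 0 & m t [[u, J v]] = 0].
  have : m t [[u, J u]] ^+ 2 + m t [[u, v]] ^+ 2 + m t [[u, J v]] ^+ 2 = 0 by nra.
  move/eqP; rewrite !paddr_eq0 ?addr_ge0 ?sqr_ge0 // !expf_eq0 /=.
  by move=> /andP[/andP[/eqP -> /eqP ->] /eqP ->].
move=> x y; rewrite (frame_lie (m_linear t)).
have -> : m t [[v, J v]] = 0 by lra.
have -> : m t [[J u, J v]] = 0 by lra.
have -> : m t [[J u, v]] = 0 by lra.
by rewrite z1 z2 z3; ring.
Qed.

(** In a unitary frame with closed first form, closedness of d alpha and the
    vanishing of the Nijenhuis tensor on (u, v) are linear equations in the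
    structure constants, which leave the ten coefficients of [kahler_eq]. The
    fifth form is - alpha / 2 because d alpha = - 2 (e^12 + e^34). *)
Lemma kahler_coframing : (forall x y, m u [[x, y]] = 0) ->
  exists a b c d f h p q r s, has_coframing g (@kahler_eq R a b c d f h p q r s).
Proof.
move=> closed_u.
have [ [e1 e2 e3 e4] [e5 e6 e7 e8 e9] e10 [f1 f2 f3 f4] [f5 f6 f7 f8] ] := frame_products.
have JJu : J (J u) = - u by rewrite JJ f5 scale0r addr0.
have JJv : J (J v) = - v by rewrite JJ f7 scale0r addr0.
have dd x y z : m (J x) [[y, z]] + m (J y) [[z, x]] + m (J z) [[x, y]] = 0.
  apply: (mulfI (_ : 2 != 0 :> R)); first by rewrite pnatr_eq0.
  by rewrite mulr0 !mulrDr -!alpha_lie -!aD lie_jacobi linear0.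
have nij e : alpha e = 0 -> - m e [[u, v]] + m e [[J u, J v]]
    + m (J e) [[J u, v]] + m (J e) [[u, J v]] = 0.
  move=> ae; have := congr1 (m e) (sas_nijenhuis S u v).
  rewrite /nijenhuis -/J JJ !mDr !mNr !mZr (mC e xi) metric_xi ae !mulr0 oppr0 addr0.
  by rewrite !metric_Phi.
have n3 := nij v f7; have n4 := nij (J v) f8; rewrite JJv mNl mNl in n4.
have n2 := nij (J u) f6; rewrite JJu !mNl !closed_u in n2.
have n1 := nij u f5; rewrite !closed_u in n1.
have d1 := dd u (J u) v; have d2 := dd u (J u) (J v).
have d3 := dd u v (J v); have d4 := dd (J u) v (J v).
rewrite (lieC v u) JJu !mNl !mNr !closed_u in d1.
rewrite (lieC (J v) u) JJu JJv !mNl !mNr !closed_u in d2.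
rewrite (lieC (J v) u) JJv !mNl !mNr in d3.
rewrite (lieC (J v) (J u)) JJu JJv !mNl !mNr !closed_u in d4.
set f := m v [[J u, v]] in n3 n4 d4 *.
set h := - m (J v) [[u, J v]].
exists (- m (J u) [[u, J u]]), (- m (J u) [[u, v]]), (- m (J u) [[u, J v]]),
  (- m v [[u, v]]), f, h, (- m v [[u, J v]] - f), (h - m v [[J u, J v]]),
  (- m v [[v, J v]]), (- m (J v) [[v, J v]]).
pose t x := vec 5 [:: m u x; m (J u) x; m v x; m (J v) x; - alpha x / 2].
apply: (@coframing_of_function _ _ _ _ t).
- by move=> k x y; each_coordinate; rewrite !(coD, coZ) !co_vec //= ?aD ?aZ ?mDr ?mZr //; ring.
- move=> x y txy.
  have E i := congr1 (fun z : 'rV[R]_5 => co z i) txy.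
  have := (E 1, E 2, E 3, E 4, E 5)%N; rewrite /t !co_vec //=.
  move=> [ [ [ [E1 E2] E3] E4] E5].
  rewrite (frame_expansion x) (frame_expansion y) E1 E2 E3 E4.
  by have -> : alpha x = alpha y by lra.
have a_lin : linear_for *%R alpha by move=> k x y; rewrite aD aZ.
move=> x y; each_coordinate; expand_coordinates.
- by rewrite closed_u oppr0.
- rewrite (frame_lie (m_linear _)) /h.
  have -> : m (J u) [[J u, v]] = - m (J u) [[u, J v]] by lra.
  have -> : m (J u) [[J u, J v]] = m (J u) [[u, v]] by lra.
  have -> : m (J u) [[v, J v]] = m v [[u, v]] + m (J v) [[u, J v]] by lra.
  by ring.
- rewrite (frame_lie (m_linear _)) -/f /h.
  have -> : m v [[u, J u]] = m (J u) [[u, v]] by lra.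
  by ring.
- rewrite (frame_lie (m_linear _)) /h.
  have -> : m (J v) [[u, J u]] = m (J u) [[u, J v]] by lra.
  have -> : m (J v) [[u, v]] = - m v [[u, J v]] - 2 * f by lra.
  have -> : m (J v) [[J u, v]] = m v [[u, v]] - m (J v) [[u, J v]] - m v [[J u, J v]] by lra.
  have -> : m (J v) [[J u, J v]] = - f by lra.
  by ring.
- by rewrite (frame_lie a_lin) !alpha_lie e2 e8 e9 e4 JJu !mNl e6 e7; field.
Qed.

End Frame.

Lemma sasakian_kahler_eq :
  exists a b c d f h p q r s, has_coframing g (@kahler_eq R a b c d f h p q r s).
Proof.
have [||u0 u0_neq0 au0] := @nontrivial_kernel _ g 1 (fun x => vec 1 [:: alpha x]).
- by move=> a x y; apply: coP => i; rewrite inE => /eqP ->;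
    rewrite !(coD, coZ) !co_vec //= aD aZ.
- by rewrite dimg.
have {}au0 : alpha u0 = 0 by have := congr1 (fun z : 'rV[R]_1 => co z 1) au0; rewrite co_vec // co0.
have [a _ uu] := unit_multiple u0_neq0.
have [|v uv] := exists_unitary_frame uu; first by rewrite aZ au0 mulr0.
have [w [w0 aw closed_w] ] := exists_closed_form uv.
have [b _ ww] := unit_multiple w0.
have [|v' wv'] := exists_unitary_frame ww; first by rewrite aZ aw mulr0.
by apply: (kahler_coframing wv') => x y; rewrite mZl closed_w mulr0.
Qed.

End Sasakian.

(** * Products and semidirect products *)

Lemma lieZl (R : fieldType) (g : lieAlgType R) a (x y : g) :
  [[a *: x, y]] = a *: [[x, y]].
Proof. by rewrite lieC lieZr -scalerN -lieC. Qed.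

Section DerivationAction.
Variables (R : fieldType) (n : lieAlgType R) (D : n -> n).
Hypothesis linD : linear D.
Hypothesis derD : forall u v, D [[u, v]] = [[D u, v]] + [[u, D v]].

Let Dlin : {linear n -> n} :=
  HB.pack_for {linear n -> n} D (GRing.isLinear.Build _ _ _ _ D linD).

Definition derivation_scale (x : abelian R^o) : 'End(n) := (x : R) *: linfun Dlin.

Fact derivation_scale_linear : linear derivation_scale.
Proof. by move=> a x y; rewrite /derivation_scale scalerDl scalerA. Qed.

HB.instance Definition _ :=
  GRing.isLinear.Build R (abelian R^o) 'End(n) *:%R derivation_scale
    derivation_scale_linear.

Lemma derivation_scaleE x u : derivation_scale x u = (x : R) *: D u.
Proof. by rewrite scale_lfunE lfunE. Qed.

Fact derivation_scale_der x u v :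
  derivation_scale x [[u, v]] = [[derivation_scale x u, v]] + [[u, derivation_scale x v]].
Proof.
by rewrite !derivation_scaleE derD scalerDr lieZr lieZl.
Qed.

Fact derivation_scale_lie x y u : derivation_scale [[x, y]] u =
  derivation_scale x (derivation_scale y u) - derivation_scale y (derivation_scale x u).
Proof.
have DZ (a : R) z : D (a *: z) = a *: D z by exact: (linearZ_LR Dlin).
by rewrite !derivation_scaleE !DZ !scalerA mulrC subrr scale0r.
Qed.

(** The existential form keeps the action opaque, so that only its values are
    visible when brackets of the semidirect product are computed. *)
Lemma derivation_action : exists rho : lie_action (abelian R^o) n,
  forall (x : abelian R^o) u, rho x u = (x : R) *: D u.
Proof.
by exists (LieAction derivation_scale_der derivation_scale_lie) => x u;
  apply: derivation_scaleE.
Qed.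

End DerivationAction.

Lemma lie_isog_of (R : fieldType) (g h : lieAlgType R) (f : g -> h) (f' : h -> g) :
  linear f -> cancel f f' -> \dim {:g} = \dim {:h} ->
  (forall x y, f [[x, y]] = [[f x, f y]]) -> g ~= h.
Proof.
move=> linf fK eq_dim flie; pose fl := HB.pack_for {linear g -> h} f
  (GRing.isLinear.Build _ _ _ _ f linf).
by exists fl; split=> //; exact: (inj_linear_bij (f := fl) (can_inj fK) eq_dim).
Qed.

Lemma heis_lie (R : fieldType) n (u v : heis R n) :
  [[u, v]] = ((0, 0), \sum_(i < n)
    (co u.1.1 i.+1 * co v.1.2 i.+1 - co v.1.1 i.+1 * co u.1.2 i.+1)).
Proof. by congr (_, _); apply: eq_bigr => i _; rewrite !co_ord. Qed.

Lemma prod_lie (R : fieldType) (g h : lieAlgType R) (u v : g * h) :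
  [[u, v]] = ([[u.1, v.1]], [[u.2, v.2]]).
Proof. by []. Qed.

Lemma semidirect_lie (R : fieldType) (h n : lieAlgType R) (rho : lie_action h n)
    (u v : semidirect rho) :
  [[u, v]] = ([[u.1, v.1]], [[u.2, v.2]] + rho u.1 v.2 - rho v.1 u.2).
Proof. by []. Qed.

Lemma abelian_lie (R : fieldType) (V : vectType R) (u v : abelian V) : [[u, v]] = 0.
Proof. by []. Qed.

Section PairComponents.
Variables (R : fieldType) (U V : lmodType R).
Implicit Types u v : (U * V)%type.
Lemma fstD u v : (u + v).1 = u.1 + v.1. Proof. by []. Qed.
Lemma sndD u v : (u + v).2 = u.2 + v.2. Proof. by []. Qed.
Lemma fstN u : (- u).1 = - u.1. Proof. by []. Qed.
Lemma sndN u : (- u).2 = - u.2. Proof. by []. Qed.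
Lemma fstZ a u : (a *: u).1 = a *: u.1. Proof. by []. Qed.
Lemma sndZ a u : (a *: u).2 = a *: u.2. Proof. by []. Qed.
Lemma pair_ext u v : u.1 = v.1 -> u.2 = v.2 -> u = v.
Proof. by case: u v => [a b] [c d] /= -> ->. Qed.
End PairComponents.

Definition pairE := (fstD, sndD, fstN, sndN, fstZ, sndZ).

Ltac split_components :=
  do ?[apply: pair_ext]; rewrite ?pairE /=; try each_coordinate.
Ltac finish :=
  rewrite ?(coD, coZ, coN, co0, co_vec) //= ?(coD, coZ, coN, co0, co_vec) //=
    /GRing.scale /=.
Ltac iso_linear := by move=> a x y; split_components; finish; ring.
Ltac iso_cancel :=
  by move=> x; each_coordinate; rewrite !co_vec //= ?co_vec //=; ring.
Ltac compare_components :=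
  split_components; rewrite ?abelian_lie ?(coD, co_vec) //= ?co_lie //= ?(coN, coZ, co0, co_vec) //=
    ?(ev2D, ev2N, ev2Z, ev20) ?ev2_e // ?(co0, co_vec) //=
    ?(big_ord_recl, big_ord0) /= ?co_vec //= /GRing.scale /=; field.
Ltac iso_lie :=
  by move=> x y; rewrite ?(prod_lie, abelian_lie, heis_lie) /=; compare_components.

Section HeisDerivations.
Variables (R : fieldType) (p q r s t k : R).

(** A linear map of the plane of X and Y extends to a derivation of h_3 that acts
    on the centre by its trace. *)
Definition heis_der (u : heis R 1) : heis R 1 :=
  (vec 1 [:: p * co u.1.1 1 + q * co u.1.2 1],
   vec 1 [:: r * co u.1.1 1 + s * co u.1.2 1], (p + s) * (u.2 : R)).

Fact heis_der_linear : linear heis_der.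
Proof. iso_linear. Qed.

Fact heis_der_der u v : heis_der [[u, v]] = [[heis_der u, v]] + [[u, heis_der v]].
Proof.
rewrite /heis_der !heis_lie; split_components; rewrite ?(coD, co0, co_vec) //=
  ?(big_ord_recl, big_ord0) /= ?co_vec //=; ring.
Qed.

(** Extensions of these derivations to h_3 x R: a further generator W is sent to
    k W + t Z. *)
Definition heisR_der (u : heis R 1 * abelian R^o) : heis R 1 * abelian R^o :=
  ((heis_der u.1).1, (heis_der u.1).2 + t * (u.2 : R), k * (u.2 : R)).

Fact heisR_der_linear : linear heisR_der.
Proof. iso_linear. Qed.

Fact heisR_der_der u v : heisR_der [[u, v]] = [[heisR_der u, v]] + [[u, heisR_der v]].
Proof.
rewrite /heisR_der /heis_der !prod_lie !heis_lie !abelian_lie; split_components;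
  rewrite ?(coD, co0, co_vec) //= ?(big_ord_recl, big_ord0) /=
    ?(coD, co0, co_vec) //=; ring.
Qed.

End HeisDerivations.

Section N4Derivation.
Variable R : fieldType.

Definition n4_der (u : n4 R) : n4 R := vec 4 [:: - co u 1; 2 * co u 2; co u 3; 0].

Fact n4_der_linear : linear n4_der.
Proof. iso_linear. Qed.

Fact n4_der_der u v : n4_der [[u, v]] = [[n4_der u, v]] + [[u, n4_der v]].
Proof.
each_coordinate; rewrite ?(coD, co_vec) //= ?co_lie //=
    ?(ev2D, ev2N, ev2Z, ev20) ?ev2_e // ?(co0, co_vec) //=; ring.
Qed.
End N4Derivation.

Section Isos.
Variable R : realType.

Lemma g1_isog : g1 R ~= heis R 2.
Proof.
apply: (@lie_isog_of _ (g1 R) (heis R 2)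
  (fun x => (vec 2 [:: co x 1; co x 3], vec 2 [:: co x 2; co x 4], - co x 5))
  (fun y => vec 5 [:: co y.1.1 1; co y.1.2 1; co y.1.1 2; co y.1.2 2; - y.2])).
- iso_linear.
- iso_cancel.
- by rewrite !dimvf.
- iso_lie.
Qed.

Lemma g2_isog : g2 R ~= (aff R * heis R 1)%type.
Proof.
apply: (@lie_isog_of _ (g2 R) (aff R * heis R 1)%type
  (fun x => (vec 2 [:: co x 1; co x 2],
    (vec 1 [:: co x 3], vec 1 [:: co x 4], - (co x 5 + co x 2))))
  (fun y => vec 5 [:: co y.1 1; co y.1 2; co y.2.1.1 1; co y.2.1.2 1;
    - y.2.2 - co y.1 2])).
- iso_linear.
- iso_cancel.
- by rewrite !dimvf.
- iso_lie.
Qed.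

Lemma g4_isog : g4 R ~= (aff R * aff R * abelian R^o)%type.
Proof.
apply: (@lie_isog_of _ (g4 R) (aff R * aff R * abelian R^o)%type
  (fun x => (vec 2 [:: co x 1; co x 2], vec 2 [:: co x 3; co x 4],
    co x 5 + co x 2 + co x 4))
  (fun y => vec 5 [:: co y.1.1 1; co y.1.1 2; co y.1.2 1; co y.1.2 2;
    y.2 - co y.1.1 2 - co y.1.2 2])).
- iso_linear.
- iso_cancel.
- by rewrite !dimvf.
- iso_lie.
Qed.

Lemma g5_isog : exists rho : lie_action (abelian R^o) (heis R 1),
  g5 R ~= (abelian R^o * semidirect rho)%type.
Proof.
have [rho rhoE] := derivation_action (heis_der_linear (2^-1 : R) 0 0 2^-1)
  (heis_der_der (2^-1 : R) 0 0 2^-1); exists rho.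
apply: (@lie_isog_of _ (g5 R) (abelian R^o * semidirect rho)%type
  (fun x => (co x 3 + co x 5,
    (co x 4, (vec 1 [:: co x 1], vec 1 [:: co x 2], co x 3))))
  (fun y => vec 5 [:: co y.2.2.1.1 1; co y.2.2.1.2 1; y.2.2.2; y.2.1;
    y.1 - y.2.2.2])).
- iso_linear.
- iso_cancel.
- by rewrite !dimvf.
- move=> x y; rewrite prod_lie semidirect_lie !rhoE heis_lie abelian_lie.
  by rewrite /heis_der /=; compare_components.
Qed.

Lemma g7_isog (delta : R) : exists rho : lie_action (abelian R^o) (heis R 1),
  g7 delta ~= (abelian R^o * semidirect rho)%type.
Proof.
have [rho rhoE] := derivation_action (heis_der_linear (delta / 2) 1 (- 1) (delta / 2))
  (heis_der_der (delta / 2) 1 (- 1) (delta / 2)); exists rho.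
apply: (@lie_isog_of _ (g7 delta) (abelian R^o * semidirect rho)%type
  (fun x => (co x 3 + co x 5,
    (co x 4, (vec 1 [:: co x 1], vec 1 [:: co x 2], co x 3))))
  (fun y => vec 5 [:: co y.2.2.1.1 1; co y.2.2.1.2 1; y.2.2.2; y.2.1;
    y.1 - y.2.2.2])).
- iso_linear.
- iso_cancel.
- by rewrite !dimvf.
- move=> x y; rewrite prod_lie semidirect_lie !rhoE heis_lie abelian_lie.
  by rewrite /heis_der /=; compare_components.
Qed.

Lemma g6_isog : exists rho : lie_action (abelian R^o) (n4 R), g6 R ~= semidirect rho.
Proof.
have [rho rhoE] := derivation_action (@n4_der_linear R) (@n4_der_der R); exists rho.
apply: (@lie_isog_of _ (g6 R) (semidirect rho)
  (fun x => (co x 4, vec 4 [:: co x 2; co x 1; - co x 3; co x 5]))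
  (fun y => vec 5 [:: co y.2 2; co y.2 1; - co y.2 3; y.1; co y.2 4])).
- iso_linear.
- iso_cancel.
- by rewrite !dimvf.
- by move=> x y; rewrite semidirect_lie !rhoE /n4_der /=; compare_components.
Qed.

Lemma g3_isog : exists rho : lie_action (abelian R^o) (heis R 1 * abelian R^o)%type,
  g3 R ~= semidirect rho.
Proof.
have [rho rhoE] := derivation_action (heisR_der_linear (0 : R) 1 (- 1) 0 1 0)
  (heisR_der_der (0 : R) 1 (- 1) 0 1 0); exists rho.
apply: (@lie_isog_of _ (g3 R) (semidirect rho)
  (fun x => (co x 1, (vec 1 [:: co x 2], vec 1 [:: co x 3], - co x 5, co x 4)))
  (fun y => vec 5 [:: y.1; co y.2.1.1.1 1; co y.2.1.1.2 1; y.2.2; - y.2.1.2])).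
- iso_linear.
- iso_cancel.
- by rewrite !dimvf.
- move=> x y; rewrite semidirect_lie !rhoE prod_lie heis_lie.
  by rewrite /heisR_der /heis_der /=; compare_components.
Qed.

Lemma g8_isog (delta : R) :
  exists rho : lie_action (abelian R^o) (heis R 1 * abelian R^o)%type,
    g8 delta ~= semidirect rho.
Proof.
have [rho rhoE] := derivation_action (heisR_der_linear 0 delta (- delta) 0 (- 1) 1)
  (heisR_der_der 0 delta (- delta) 0 (- 1) 1); exists rho.
apply: (@lie_isog_of _ (g8 delta) (semidirect rho)
  (fun x => (co x 4, (vec 1 [:: co x 2], vec 1 [:: co x 3], - co x 5, co x 1)))
  (fun y => vec 5 [:: y.2.2; co y.2.1.1.1 1; co y.2.1.1.2 1; y.1; - y.2.1.2])).
- iso_linear.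
- iso_cancel.
- by rewrite !dimvf.
- move=> x y; rewrite semidirect_lie !rhoE prod_lie heis_lie.
  by rewrite /heisR_der /heis_der /=; compare_components.
Qed.

End Isos.

(** * The classification *)

Theorem theorem4p1 (R : realType) :
  (forall (g : lieAlgType R) (dim5 : \dim {:g} = 5%N) (S : sasakian g)
      (center_g : nontrivial_center g),
    g ~= g1 R \/ g ~= g2 R \/ g ~= g3 R \/ g ~= g4 R \/ g ~= g5 R \/
    g ~= g6 R \/ (exists delta : R, 0 < delta /\ g ~= g7 delta) \/
    (exists delta : R, 0 < delta /\ g ~= g8 delta)) /\
  g1 R ~= heis R 2 /\
  g2 R ~= (aff R * heis R 1)%type /\
  (exists rho : lie_action (abelian R^o) (heis R 1 * abelian R^o)%type,
    g3 R ~= semidirect rho) /\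
  g4 R ~= (aff R * aff R * abelian R^o)%type /\
  (exists rho : lie_action (abelian R^o) (heis R 1),
    g5 R ~= (abelian R^o * semidirect rho)%type) /\
  (exists rho : lie_action (abelian R^o) (n4 R), g6 R ~= semidirect rho) /\
  (forall delta : R, 0 < delta ->
    exists rho : lie_action (abelian R^o) (heis R 1),
      g7 delta ~= (abelian R^o * semidirect rho)%type) /\
  (forall delta : R, 0 < delta ->
    exists rho : lie_action (abelian R^o) (heis R 1 * abelian R^o)%type,
      g8 delta ~= semidirect rho).
Proof.
split.
  move=> g dim5 S center_g; have xi_center := xi_central S center_g.
  have [a [b [c [d [f [h [p [q [r [s H] ] ] ] ] ] ] ] ] ] :=
    sasakian_kahler_eq dim5 xi_center.
  exact: classify_kahler dim5 _ _ _ _ _ _ _ _ _ _ H.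
split; first exact: g1_isog.
split; first exact: g2_isog.
split; first exact: g3_isog.
split; first exact: g4_isog.
split; first exact: g5_isog.
split; first exact: g6_isog.
by split=> delta _; [exact: g7_isog | exact: g8_isog].
Qed.
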